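(* Let $(b_n)_{n\ge 0}$ and $(b_n^r)_{n\ge 0}$ be the joining (non-balking) probabilities in an $M/M/1$ processor sharing (PS) queue and an $M/M/1$ random order of service (ROS) queue with balking, respectively, both with the same Poisson arrival rate $\rho>0$ and service rate $1$, and with $b_0=1$. If $b_0^r=1$ and $b_n^r=b_{n-1}$ for $n=1,2,\ldots$, then for every $n\ge 0$ $$\mathcal{V}_n\stackrel{d}{=}\mathcal{W}_n ,$$ and for all $t\ge 0$ $$\mathrm{Prob}[\mathcal{V}>t]=C\cdot \mathrm{Prob}[\mathcal{W}>t],\qquad C=\frac{1}{\rho}\cdot\frac{1+\sum_{n=1}^{\infty}\rho^n\, b_0 b_1\cdots b_{n-1}}{1+\sum_{n=1}^{\infty}\rho^n\, b_0 b_1\cdots b_{n}} .$$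
   Context: Customers arrive according to a Poisson process of rate $\lambda=\rho$ and have i.i.d. exponential service requirements with mean $1$ (so the traffic intensity is $\rho$). An arriving customer who finds $n$ customers in the system (including any customer in service) joins with probability $b_n$ in the PS system and with probability $b_n^r$ in the ROS system; otherwise the customer balks, i.e. does not enter and is lost. Balking decisions are independent of everything else. PS discipline: when $k\ge 1$ customers are in the system, each receives service at rate $1/k$. ROS discipline: a single server serves one customer at a time; at each service completion the next customer to be served is chosen uniformly at random among those waiting (and a joining customer who finds the system empty starts service immediately). $\mathcal{V}_n$ is the sojourn time of a non-balking (joining) customer who arrives to the PS queue and finds $n$ other customers competing for service. $\mathcal{W}_n$ is the waiting time (until start of service) of a non-balking customer who arrives to the ROS queue and finds $n$ other customers waiting for service and one additional customer in service. $\mathcal{V}$ is the steady-state sojourn time of a non-balking customer in the PS queue and $\mathcal{W}$ is the steady-state waiting time of a non-balking customer in the ROS queue (equal to $0$ if the system is found empty). Both systems are assumed to be in steady state, with $\sum_{n\ge 1}\rho^n b_0\cdots b_{n-1}<\infty$; the number of customers present at an arrival epoch equals $n$ with probability proportional to $\rho^n b_0\cdots b_{n-1}$ in the PS system and to $\rho^n b_0^r\cdots b_{n-1}^r$ in the ROS system, so that for instance $$\mathrm{Prob}[\mathcal{V}>t]=\frac{\sum_{n=0}^{\infty}\rho^n b_0\cdots b_{n}\,\mathrm{Prob}[\mathcal{V}_{n}>t]}{\sum_{n=0}^{\infty}\rho^n b_0\cdots b_{n}},\qquad \mathrm{Prob}[\mathcal{W}>t]=\frac{\sum_{n=0}^{\infty}\rho^{n+1}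 b_0^r\cdots b_{n+1}^r\,\mathrm{Prob}[\mathcal{W}_{n}>t]}{\sum_{n=0}^{\infty}\rho^{n} b_0^r\cdots b_{n}^r}.$$ *)

(* Defs.v *)
From HB Require Import structures.
From mathcomp Require Import all_boot all_order all_algebra.
From mathcomp Require Import all_classical all_reals all_analysis.
From mathcomp Require Import measurable_realfun.

Set Implicit Arguments.
Unset Strict Implicit.
Unset Printing Implicit Defensive.

Import Order.TTheory GRing.Theory Num.Theory.
Import numFieldNormedType.Exports.

Local Open Scope classical_set_scope.
Local Open Scope ring_scope.

(* Sample-path dynamics.  A tagged customer, arrival number 0, joins at time 0;
   the later arrivals are numbered 1, 2, ...  [gap j] is the time between
   arrivals j and j+1, [work j] is the service requirement of arrival j, and
   arrival j joins iff [mark j] is below the joining probability [b k], k being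
   the number of customers it finds in the system.  The i-th customer found by
   the tagged customer has remaining requirement [residual i].  States are
   given just after an event (an arrival or a service completion). *)

(* [absorption_time] is the clock at the first state satisfying [final], and
   +oo if there is none: below, [step] fixes the states satisfying [final], so
   that the set has at most one element. *)
Definition absorption_time (R : realType) (S : Type) (step : S -> S)
    (clock : S -> R) (final : S -> bool) (x : S) : \bar R :=
  ereal_inf [set (clock (iter m step x))%:E
            | m in [set m | final (iter m step x)]].

Section processor_sharing.
Context {R : realType}.

Record ps_state := PSState {
  ps_clock : R;
  ps_tagged : R;       (* remaining requirement of the tagged customer *)
  ps_others : seq R;   (* remaining requirements of the other customers *)
  ps_next : R;         (* time until the next arrival *)
  ps_arrival : nat     (* number of the next arrival *)
}.

Variables (b : nat -> R) (residual gap work mark : nat -> R).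

Definition ps_done (x : ps_state) : bool := ps_tagged x <= 0.

(* With k customers in the system, a period of length s reduces every remaining
   requirement by s / k, so the customer with the smallest remaining
   requirement r completes after a time k * r, unless an arrival comes first. *)
Definition ps_step (x : ps_state) : ps_state :=
  if ps_done x then x else
  let k := (size (ps_others x)).+1 in
  let r := \big[Num.min/ps_tagged x]_(v <- ps_others x) v in
  let a := ps_next x in
  let j := ps_arrival x in
  if k%:R * r <= a then
    PSState (ps_clock x + k%:R * r) (ps_tagged x - r)
      [seq v - r | v <- ps_others x & r < v] (a - k%:R * r) j
  else
    let others := [seq v - a / k%:R | v <- ps_others x] in
    PSState (ps_clock x + a) (ps_tagged x - a / k%:R)
      (if mark j < b k then rcons others (work j) else others) (gap j) j.+1.

Definition ps_init (n : nat) : ps_state :=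
  PSState 0 (work 0%N) (mkseq residual n) (gap 0%N) 1.

Definition ps_sojourn_path (n : nat) : \bar R :=
  absorption_time ps_step ps_clock ps_done (ps_init n).

End processor_sharing.

Section random_order_of_service.
Context {R : realType}.

Record ros_state := ROSState {
  ros_clock : R;
  ros_started : bool;     (* the service of the tagged customer has started *)
  ros_server : R;         (* remaining requirement of the customer in service *)
  ros_waiting : seq R;    (* requirements of the other waiting customers *)
  ros_next : R;           (* time until the next arrival *)
  ros_arrival : nat;      (* number of the next arrival *)
  ros_completion : nat    (* number of the next service completion *)
}.

Variables (b : nat -> R) (residual gap work mark pick : nat -> R).

(* At a service completion with m waiting customers besides the tagged one,
   floor (pick c * (m + 1)), which is uniform on {0, ..., m} when pick c is
   uniform on [0, 1], designates the next customer to be served: 0 stands for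
   the tagged customer and i + 1 for the i-th other waiting customer. *)
Definition ros_step (x : ros_state) : ros_state :=
  if ros_started x then x else
  let w := ros_waiting x in
  let m := size w in
  let s := ros_server x in
  let a := ros_next x in
  let j := ros_arrival x in
  let c := ros_completion x in
  if s <= a then
    if Num.truncn (pick c * m.+1%:R) is i.+1 then
      ROSState (ros_clock x + s) false (nth 0 w i) (take i w ++ drop i.+1 w)
        (a - s) j c.+1
    else ROSState (ros_clock x + s) true (work 0%N) w (a - s) j c.+1
  else
    ROSState (ros_clock x + a) false (s - a)
      (if mark j < b m.+2 then rcons w (work j) else w) (gap j) j.+1 c.

(* The customer in service at time 0 has remaining requirement [residual 0]. *)
Definition ros_init (n : nat) : ros_state :=
  ROSState 0 false (residual 0%N) (mkseq (fun i => residual i.+1) n)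
    (gap 0%N) 1 0.

Definition ros_wait_path (n : nat) : \bar R :=
  absorption_time ros_step ros_clock ros_started (ros_init n).

End random_order_of_service.

Section probability_notions.
Context {R : realType}.

Definition mutually_independent d (T : measurableType d) (P : probability T R)
    (I : Type) (X : I -> T -> R) : Prop :=
  forall (k : nat) (i : 'I_k -> I) (B : 'I_k -> set R), injective i ->
    (forall l, measurable (B l)) ->
    P (\bigcap_(l in [set: 'I_k]) (X (i l) @^-1` B l)) =
    (\prod_(l < k) P (X (i l) @^-1` B l))%E.

Definition has_law d (T : measurableType d) (P : probability T R)
    (X : T -> R) (mu : set R -> \bar R) : Prop :=
  forall B : set R, measurable B -> P (X @^-1` B) = mu B.

Definition eq_in_law d (T : measurableType d) (P : probability T R)
    d' (T' : measurableType d') (P' : probability T' R)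
    (X : T -> \bar R) (X' : T' -> \bar R) : Prop :=
  [/\ measurable_fun setT X, measurable_fun setT X' &
      forall B : set (\bar R), measurable B -> P (X @^-1` B) = P' (X' @^-1` B)].

Definition cond_prob d (T : measurableType d) (P : probability T R)
    (A B : set T) : R := fine (P (A `&` B)) / fine (P B).

End probability_notions.

Section queues.
Context {R : realType}.

(* [found] is the number of customers present when the tagged customer
   arrives. *)
Record queue_data d (T : measurableType d) (P : probability T R) := QueueData {
  found : {RV P >-> nat};
  residual : nat -> {RV P >-> R};
  gap : nat -> {RV P >-> R};
  work : nat -> {RV P >-> R};
  mark : nat -> {RV P >-> R}
}.

Inductive source :=
  | Found | Residual of nat | Gap of nat | Work of nat | Mark of nat.

Section definitions.
Context d (T : measurableType d) (P : probability T R).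
Implicit Types (X : queue_data P) (pick : nat -> {RV P >-> R}) (b : nat -> R).

Definition source_rv X (s : source) : T -> R :=
  match s with
  | Found => fun w => (found X w)%:R
  | Residual i => residual X i
  | Gap j => gap X j
  | Work j => work X j
  | Mark j => mark X j
  end.

(* By the memoryless property, the remaining requirements of the customers found
   by the tagged customer are exponential with mean 1. *)
Definition balking_laws (rho : R) b X : Prop :=
  [/\ exists c : R, forall n : nat,
        P (found X @^-1` [set n]) = (c * (rho ^+ n * \prod_(i < n) b i))%:E,
      forall i, has_law P (residual X i) (exponential_prob 1),
      forall j, has_law P (gap X j) (exponential_prob rho),
      forall j, has_law P (work X j) (exponential_prob 1) &
      forall j, has_law P (mark X j) (uniform_prob (@ltr01 R))].

Definition ps_queue (rho : R) b X : Prop :=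
  balking_laws rho b X /\ mutually_independent P (source_rv X).

Definition ros_queue (rho : R) b X pick : Prop :=
  [/\ balking_laws rho b X,
      forall c, has_law P (pick c) (uniform_prob (@ltr01 R)) &
      mutually_independent P (fun s : source + nat =>
        match s with inl s => source_rv X s | inr c => pick c end)].

Definition ps_sojourn b X (n : nat) (w : T) : \bar R :=
  ps_sojourn_path b (residual X ^~ w) (gap X ^~ w) (work X ^~ w) (mark X ^~ w)
    n.

Definition ros_wait b X pick (n : nat) (w : T) : \bar R :=
  ros_wait_path b (residual X ^~ w) (gap X ^~ w) (work X ^~ w) (mark X ^~ w)
    (pick ^~ w) n.

Definition joins b X : set T := [set w | mark X 0%N w < b (found X w)].

Definition ps_sojourn_steady b X (w : T) : \bar R :=
  ps_sojourn b X (found X w) w.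

Definition ros_wait_steady b X pick (w : T) : \bar R :=
  if found X w is n.+1 then ros_wait b X pick n w else 0%E.

Definition ps_tail b X (t : R) : R :=
  cond_prob P [set w | (t%:E < ps_sojourn_steady b X w)%E] (joins b X).

Definition ros_tail b X pick (t : R) : R :=
  cond_prob P [set w | (t%:E < ros_wait_steady b X pick w)%E] (joins b X).

End definitions.

End queues.

(* Main.v *)
Require Import Defs.
From HB Require Import structures.
From mathcomp Require Import all_boot all_order all_algebra.
From mathcomp Require Import all_classical all_reals all_analysis.
From mathcomp Require Import measurable_realfun.
From mathcomp Require Import ring.

Set Implicit Arguments.
Unset Strict Implicit.
Unset Printing Implicit Defensive.

Import Order.TTheory GRing.Theory Num.Theory.
Import numFieldNormedType.Exports.

Local Open Scope classical_set_scope.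
Local Open Scope ring_scope.

(** Watched from the tagged customer, both queues are the same random race.

    Processor sharing, n other customers present: the remaining requirements of
    the n + 1 customers are independent, exponential of mean 1, and served at
    rate 1 / (n + 1), so the next completion comes after an exponential time of
    mean 1 and concerns each of the n + 1 customers with the same probability.
    If it is the tagged customer, the sojourn ends; otherwise n decreases.
    A customer arriving meanwhile finds n + 1 customers and joins with
    probability b_(n+1).  Random order of service, n other customers waiting:
    the next completion comes after an exponential time of mean 1 and the
    customer taken into service is uniform among the n + 1 waiting ones.  If it
    is the tagged customer, the wait ends; otherwise n decreases.  A customer
    arriving meanwhile finds n + 2 customers and joins with probability
    b^r_(n+2) = b_(n+1).  The two times of absorption therefore have the same
    law.

    This is made precise with the function [served_within]: the probability,
    computed by recursion on m, of being absorbed by time t and within m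
    events.  [ps_left_law] and [ros_served_law] show by induction on m that each
    system satisfies this recursion, and letting m grow gives the same
    distribution function on both sides ([ps_sojourn_cdf], [ros_wait_cdf]).

    The induction is carried out without conditional expectations.  The joint
    law of all the input variables is a measure on the space of real functions
    of their indices, and it is determined by the product rule
    ([product_law_unique]).  It is therefore invariant under redrawing one
    coordinate ([resample]) and under renaming coordinates that have the same
    law ([product_law_relabel]).  Redrawing an exponential coordinate yields the
    memoryless property: beyond u, this coordinate is u plus a fresh copy
    ([memoryless_coord], [memoryless_coords]).  After the first event the system
    has the shape of an initial state up to such changes of coordinates, whence
    the recursion.  In the processor sharing queue the first completion
    is a race between n + 1 requirements; integrating over the smallest one, u,
    gives the factor exp(- n u) for the others, and the completion time
    (n + 1) u turns it into the uniform weight 1 / (n + 1)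
    ([integral_exp_law_scale]).

    For the steady state, the number found is independent of the dynamics and
    of the mark deciding whether the tagged customer joins, so both tails are
    quotients of series ([cond_prob_over_found]).  Since b^r_0 ... b^r_(n+1) =
    b_0 ... b_n, the numerator for random order of service is rho times the
    numerator for processor sharing, and the constant is the remaining quotient
    of the denominators. *)

(** * Exponential and uniform laws on the line *)

(** The measurability proof is an argument because the measure structure of a
    pushforward depends on it. *)
Definition image_measure d d' (T : measurableType d) (T' : measurableType d')
  (R : realType) (m : {measure set T -> \bar R}) (f : T -> T')
  (mf : measurable_fun setT f) : {measure set T' -> \bar R}.
Proof.
by unshelve refine (pushforward m f : {measure set T' -> \bar R}).
Defined.

Section line.
Context {R : realType}.
Notation L := (measurableTypeR R).
Implicit Types (x u rate : R) (b : bool).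

Lemma eq_measure_rays (m1 m2 : {measure set L -> \bar R}) :
  (m1 setT < +oo)%E -> (forall x, m1 `]x, +oo[%classic = m2 `]x, +oo[%classic) ->
  forall A, measurable A -> m1 A = m2 A.
Proof.
move=> m1oo m12 A; apply: (@measure_unique _ R L (@RGenOInfty.G R)
  (fun k => `](- k%:R)%R, +oo[%classic)).
- exact: RGenOInfty.measurableE.
- move=> _ _ [x ->] [y ->]; exists (Num.max x y).
  apply/seteqP; split => z /=; rewrite !in_itv/= !andbT gt_max.
    by move=> [-> ->].
  by move=> /andP[].
- by move=> k; exists (- k%:R).
- rewrite -subTset => x _; exists (Num.bound `|x|) => //=.
  rewrite in_itv/= andbT ltrNl.
  by rewrite (le_lt_trans (ler_norm _))// normrN archi_boundP.
- by move=> _ [x ->].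
- by move=> k; apply: le_lt_trans m1oo; apply: le_measure; rewrite ?inE.
Qed.

(** The law is sealed behind a sigma type so that conversion never unfolds its
    density; [exp_lawE] is the only access to it. *)
Fact exp_law_subproof rate (rate_gt0 : 0 < rate) :
  {P : probability L R | P = exponential_prob rate :> (set L -> \bar R)}.
Proof.
by unshelve eexists (exponential_prob rate : probability L R).
Qed.

Definition exp_law rate (rate_gt0 : 0 < rate) : probability L R :=
  sval (exp_law_subproof rate_gt0).

Lemma exp_lawE rate (rate_gt0 : 0 < rate) (A : set L) :
  exp_law rate_gt0 A = exponential_prob rate A.
Proof. by rewrite /exp_law; case: exp_law_subproof => P /= ->. Qed.

Lemma exp_law_ray rate (rate_gt0 : 0 < rate) b x : 0 <= x ->
  exp_law rate_gt0 [set` Interval (BSide b x) +oo%O] = (expR (- rate * x))%:E.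
Proof.
move=> x0; rewrite exp_lawE /exponential_prob.
have mf (D : set L) : measurable_fun D (EFin \o exponential_pdf rate).
  by apply/measurable_EFinP/measurable_funTS; exact: measurable_exponential_pdf.
have cont : continuous (fun z : R^o => expR (- rate * z)).
  move=> z; apply: continuous_comp; last exact: continuous_expR.
  by apply: continuousM => //; apply: (@continuousN _ R^o); exact: cst_continuous.
suff cbnd : (\int[lebesgue_measure]_(z in `[x, +oo[) (exponential_pdf rate z)%:E
    = (expR (- rate * x))%:E)%E.
  case: b; first exact: cbnd.
  by rewrite integral_itv_obnd_cbnd; [exact: cbnd|exact: mf].
rewrite (@ge0_continuous_FTC2y _ _
  (fun x => - (expR (- rate * x))) x 0)//.
- by rewrite EFinN oppeK add0e.
- by move=> z _; apply: exponential_pdf_ge0; exact: ltW.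
- apply: (@continuous_subspaceW R^o _ _ [set` `[0, +oo[%R]).
  + by move=> z /=; rewrite !in_itv/= !andbT; exact: le_trans.
  + exact: within_continuous_exponential_pdf.
- rewrite -oppr0; apply: cvgN.
  rewrite (_ : (fun x => expR (- rate * x)) =
               (fun z => expR (- z)) \o (fun z => rate * z)); last first.
    by apply: eq_fun => z; rewrite mulNr.
  apply: (@cvg_comp _ _ _ _ _ _ (pinfty_nbhs R)); last exact: cvgr_expR.
  exact: gt0_cvgMry.
- by apply: cvgN; apply/cvg_at_right_filter; exact: cont.
- move=> z; rewrite in_itv/= andbT => xz.
  by rewrite derive1_exponential_pdf// in_itv/= andbT (le_lt_trans x0).
Qed.

Lemma exp_law_pos rate (rate_gt0 : 0 < rate) b x : x <= 0 ->
  exp_law rate_gt0 [set` Interval (BSide b x) +oo%O] = 1%E.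
Proof.
rewrite le_eqVlt => /predU1P[->|x0]; first by rewrite exp_law_ray// mulr0 expR0.
apply/eqP; rewrite eq_le probability_le1//=.
have <- : exp_law rate_gt0 `[0, +oo[%classic = 1%E by rewrite exp_law_ray// mulr0 expR0.
apply: le_measure; rewrite ?inE// => z /=; rewrite !in_itv/= !andbT => z0.
by case: b; [exact: le_trans (ltW x0) z0|exact: lt_le_trans x0 z0].
Qed.

(** Both sides are finite measures in B, so it suffices to compare them on rays,
    where the identity is exp(a + b) = exp a * exp b. *)
Lemma exp_law_memoryless rate (rate_gt0 : 0 < rate) b u (B : set L) :
  0 <= u -> measurable B ->
  exp_law rate_gt0 ([set` Interval (BSide b u) +oo%O] `&` (fun x => x - u) @^-1` B)
  = ((expR (- rate * u))%:E * exp_law rate_gt0 B)%E.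
Proof.
move=> u0 mB.
set D := [set` Interval (BSide b u) +oo%O].
have mD : measurable (D : set L) by exact: measurable_itv.
have mshift : measurable_fun setT (fun x : L => (x - u : L)).
  exact: measurable_funB.
have c0 : 0 <= expR (- rate * u) by exact: expR_ge0.
pose nu' := image_measure (mrestr (exp_law rate_gt0) mD) mshift.
have m2E A : mscale (NngNum c0) (exp_law rate_gt0) A =
    ((expR (- rate * u))%:E * exp_law rate_gt0 A)%E by [].
have nuE A : nu' A = exp_law rate_gt0 ((fun x => x - u) @^-1` A `&` D) by [].
rewrite setIC -nuE -m2E.
apply: eq_measure_rays mB.
  rewrite nuE preimage_setT setTI (le_lt_trans (probability_le1 _ _))//.
  exact: ltry.
move=> x; rewrite nuE.
transitivity ((expR (- rate * u))%:E * exp_law rate_gt0 `]x, +oo[%classic)%E => //.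
have [x0|x0] := leP 0 x.
  rewrite (_ : _ `&` _ = `]x + u, +oo[%classic).
    rewrite !exp_law_ray// ?addr_ge0//.
    rewrite -EFinM -expRD.
    by congr (expR _)%:E; rewrite mulrDr addrC.
  apply/seteqP; split => z /=; rewrite /D /= !in_itv/= !andbT ltrBrDr.
    by case.
  move=> xz; split => //.
  have uz : u < z by apply: le_lt_trans xz; rewrite lerDr.
  by case: (b); rewrite //= ltW.
rewrite [in RHS]exp_law_pos ?ltW// mule1.
rewrite (_ : _ `&` _ = D); first by rewrite exp_law_ray.
apply/seteqP; split => z /=; first by case.
rewrite /D /= !in_itv/= !andbT ltrBrDr => uz; split => //.
have : u <= z by case: (b) uz => //= /ltW.
by apply: lt_le_trans; rewrite gtrDr.
Qed.

Lemma integral_exp_law_pos rate (rate_gt0 : 0 < rate) b (f : L -> \bar R) :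
  measurable_fun setT f -> (forall x, 0 <= f x)%E ->
  (\int[exp_law rate_gt0]_x f x =
   \int[exp_law rate_gt0]_(x in [set` Interval (BSide b 0%R) +oo%O]) f x)%E.
Proof.
move=> mf f0.
have mD : measurable ([set` Interval (BSide b 0%R) +oo%O] : set L).
  exact: measurable_itv.
have D0 : exp_law rate_gt0 (~` [set` Interval (BSide b 0%R) +oo%O]) = 0%E.
  by rewrite probability_setC// exp_law_pos// subee.
rewrite (ge0_negligible_integral (measurableC mD) measurableT)//.
by rewrite setDE setTI setCK.
Qed.

Lemma integral_exp_law_memoryless rate (rate_gt0 : 0 < rate) b u
    (f : L -> \bar R) : 0 <= u ->
  measurable_fun setT f -> (forall x, 0 <= f x)%E ->
  (\int[exp_law rate_gt0]_(x in [set` Interval (BSide b u) +oo%O]) f (x - u)%R =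
   (expR (- rate * u))%:E * \int[exp_law rate_gt0]_x f x)%E.
Proof.
move=> u0 mf f0; pose D : set L := [set` Interval (BSide b 0) +oo%O].
have mD : measurable (D : set L) by exact: measurable_itv.
have mshift : measurable_fun setT (fun x : L => (x - u : L)).
  exact: measurable_funB.
have c0 : 0 <= expR (- rate * u) by exact: expR_ge0.
have DE : [set` Interval (BSide b u) +oo%O] = (fun x => x - u) @^-1` D.
  apply/seteqP; split => x; rewrite /D /= !in_itv/= !andbT;
  by case: (b); rewrite /= ?subr_ge0 ?subr_gt0.
transitivity (\int[image_measure (exp_law rate_gt0) mshift]_(x in D) f x)%E.
  by rewrite DE ge0_integral_pushforward//; exact: measurable_funTS.
rewrite (integral_exp_law_pos _ b)//.
transitivity (\int[mscale (NngNum c0) (exp_law rate_gt0)]_(x in D) f x)%E.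
  apply: eq_measure_integral => A mA AD.
  transitivity ((expR (- rate * u))%:E * exp_law rate_gt0 A)%E => //.
  rewrite -(exp_law_memoryless _ b)// DE -preimage_setI setIidr//.
by rewrite ge0_integral_mscale//; exact: measurable_funTS.
Qed.

Lemma uniform_prob_ray x : 0 <= x <= 1 ->
  uniform_prob (@ltr01 R) `]-oo, x[%classic = x%:E.
Proof.
move=> /andP[x0 x1]; rewrite /uniform_prob integral_uniform_pdf.
rewrite (_ : _ `&` _ = `[0, x[%classic); last first.
  apply/seteqP; split => z /=; rewrite !in_itv/=.
    by move=> [-> /andP[->]].
  move=> /andP[z0 zx]; split => //.
  by rewrite z0/= (le_trans (ltW zx)).
rewrite (eq_integral (fun=> 1%:E)); last first.
  move=> z; rewrite inE/= in_itv/= => /andP[z0 zx].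
  by rewrite /uniform_pdf z0 (le_trans (ltW zx))//= subr0 invr1.
rewrite integral_cst//= lebesgue_measure_itv/= lte_fin mul1e.
case: ltP => // [|xle0]; first by rewrite -EFinB subr0.
by congr EFin; apply/eqP; rewrite eq_le x0 xle0.
Qed.

Lemma exp_law_dominates rate (rate_gt0 : 0 < rate) :
  exp_law rate_gt0 `<< (@lebesgue_measure R).
Proof.
apply/null_content_dominatesP => A mA A0.
rewrite exp_lawE /exponential_prob; apply: null_set_integral => //.
by apply/measurable_EFinP/measurable_funTS; exact: measurable_exponential_pdf.
Qed.

Lemma exp_law_set1 rate (rate_gt0 : 0 < rate) (x : R) :
  exp_law rate_gt0 [set x] = 0%E.
Proof.
have /null_content_dominatesP := exp_law_dominates rate_gt0.
by apply=> //; exact: lebesgue_measure_set1.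
Qed.

Lemma ge0_integral_exp_law rate (rate_gt0 : 0 < rate) (D : set L) (f : L -> \bar R) :
  measurable D -> measurable_fun D f -> (forall x, 0 <= f x)%E ->
  (\int[exp_law rate_gt0]_(x in D) f x =
   \int[lebesgue_measure]_(x in D) (f x * (exponential_pdf rate x)%:E))%E.
Proof.
move=> mD mf f0; have dom := exp_law_dominates rate_gt0.
rewrite -(Radon_Nikodym_SigmaFinite.change_of_variables dom f0 mD mf).
have fint := Radon_Nikodym_SigmaFinite.f_integrable dom.
have mpdf (E : set L) : measurable_fun E (EFin \o exponential_pdf rate).
  by apply/measurable_EFinP/measurable_funTS; exact: measurable_exponential_pdf.
apply: ae_eq_integral => //.
- apply: emeasurable_funM => //; apply: measurable_funTS.
  exact: measurable_int fint.
- by apply: emeasurable_funM => //; exact: mpdf.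
- apply: ae_eqe_mul2l; apply: integral_ae_eq => //.
  + exact: (integrableS measurableT mD (@subsetT _ D) fint).
  + move=> E ED mE; rewrite -Radon_Nikodym_SigmaFinite.f_integral//.
    exact: exp_lawE.
Qed.

(** A survival factor exp(- a x) against a density r exp(- r x) is, up to the
    constant r / (r + a), the density of rate r + a: this computes the minimum
    of independent exponential variables. *)
Lemma exp_law_tilt rate a (rate_gt0 : 0 < rate) (ra_gt0 : 0 < rate + a)
    (D : set L) (g : L -> \bar R) : measurable D ->
    measurable_fun D g -> (forall x, 0 <= g x)%E ->
  (\int[exp_law rate_gt0]_(x in D) ((expR (- a * x))%:E * g x) =
   (rate / (rate + a))%:E * \int[exp_law ra_gt0]_(x in D) g x)%E.
Proof.
move=> mD mg g0.
have mexp : measurable_fun D (EFin \o (fun x : L => expR (- a * x))).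
  apply/measurable_EFinP; apply: measurable_funTS; apply: measurableT_comp => //. 
have mpdf r : measurable_fun D (EFin \o exponential_pdf r).
  by apply/measurable_EFinP/measurable_funTS; exact: measurable_exponential_pdf.
rewrite !ge0_integral_exp_law//; last 2 first.
- by apply: emeasurable_funM => //; exact: mexp.
- by move=> x; rewrite mule_ge0// lee_fin expR_ge0.
rewrite -ge0_integralZl//; last 3 first.
- by apply: emeasurable_funM => //; exact: mpdf.
- by move=> x _; rewrite mule_ge0// lee_fin exponential_pdf_ge0// ltW.
- by rewrite lee_fin divr_ge0// ltW.
apply: eq_integral => x _; rewrite muleAC muleCA muleC -!EFinM; congr (_ * _%:E)%E.
have [x0|x0] := ltP x 0; first by rewrite !lt0_exponential_pdf// !mulr0.
rewrite !exponential_pdfE// mulrCA [RHS]mulrA divfK ?gt_eqF//; congr (_ * _).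
by rewrite -expRD; congr expR; ring.
Qed.

Lemma exp_law_scale rate rate' (k : R) (rate_gt0 : 0 < rate) (k_gt0 : 0 < k)
    (rate'_gt0 : 0 < rate') (f : L -> \bar R) : rate' = rate * k ->
    measurable_fun setT f -> (forall x, 0 <= f x)%E ->
  (\int[exp_law rate'_gt0]_(x in `]0%R, +oo[) f (k * x)%R =
   \int[exp_law rate_gt0]_(x in `]0%R, +oo[) f x)%E.
Proof.
move=> rk mf f0; subst rate'.
have mk : measurable_fun setT (fun x : L => (k * x : L)) by exact: mulrl_measurable.
transitivity (\int[image_measure (exp_law rate'_gt0) mk]_(x in `]0%R, +oo[) f x)%E.
  rewrite ge0_integral_pushforward//; last exact: measurable_funTS.
  congr integral; apply/seteqP; split => z /=; rewrite !in_itv/= !andbT.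
    by move=> z0; rewrite mulr_gt0.
  by rewrite pmulr_rgt0.
apply: eq_measure_integral => A mA _.
apply: eq_measure_rays mA.
  by rewrite -[X in (X < _)%E]/(exp_law rate'_gt0 setT) probability_setT ltry.
move=> x.
have -> : image_measure (exp_law rate'_gt0) mk `]x, +oo[%classic =
    exp_law rate'_gt0 `]x / k, +oo[%classic.
  congr (exp_law _ _); apply/seteqP; split => z /=; rewrite !in_itv/= !andbT.
    by rewrite ltr_pdivrMr// mulrC.
  by rewrite ltr_pdivrMr// mulrC.
transitivity (exp_law rate_gt0 `]x, +oo[%classic) => //.
transitivity (exp_law rate'_gt0 `]x / k, +oo[%classic) => //.
have [x0|/ltW x0] := leP 0 x.
  have xk0 : 0 <= x / k by rewrite divr_ge0// ltW.
  apply: etrans (exp_law_ray rate'_gt0 false xk0) _; rewrite exp_law_ray//.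
  by congr EFin; congr expR; field; rewrite gt_eqF.
have xk0 : x / k <= 0 by rewrite mulr_le0_ge0// invr_ge0 ltW.
by apply: etrans (exp_law_pos rate'_gt0 false xk0) _; rewrite exp_law_pos.
Qed.

(** The origin of the uniform weight 1 / (n + 1) in processor sharing: u is the
    requirement of the customer who completes first, exp(- n u) is the
    probability that the n others need more than u, and (n + 1) u is the time
    at which the completion occurs.  Tilting by exp(- n u) gives rate n + 1, and
    the factor n + 1 brings the rate back to 1. *)
Lemma integral_exp_law_scale n (f : L -> \bar R) :
  measurable_fun setT f -> (forall x, 0 <= f x)%E ->
  (\int[exp_law (@ltr01 R)]_(u in `]0%R, +oo[)
      ((expR (- n%:R * u))%:E * f (n.+1%:R * u)%R) =
   (n.+1%:R^-1)%:E * \int[exp_law (@ltr01 R)]_(s in `]0%R, +oo[) f s)%E.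
Proof.
move=> mf f0.
have n1_gt0 : 0 < 1 + n%:R :> R by rewrite ltr_pwDl.
have mfk : measurable_fun setT (fun u : L => f (n.+1%:R * u)).
  by apply: measurableT_comp => //; exact: mulrl_measurable.
have tilt := @exp_law_tilt 1 n%:R ltr01 n1_gt0 `]0%R, +oo[%classic
  (fun u => f (n.+1%:R * u)) (measurable_itv _) (measurable_funTS mfk) (fun u => f0 _).
have n0 : 0 < n.+1%:R :> R by rewrite ltr0n.
have n1E : 1 + n%:R = 1 * n.+1%:R :> R by rewrite mul1r -natr1 addrC.
have scale := exp_law_scale ltr01 n0 n1_gt0 n1E mf f0.
by apply: etrans tilt _; rewrite scale div1r n1E mul1r.
Qed.

End line.

(** * Independent families as measures on a function space *)

Section streams.
Context {R : realType} (I : eqType).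
Notation L := (measurableTypeR R).

Definition cylinders : set (set (I -> R)) :=
  [set A | exists i (B : set L), measurable B /\ A = (fun z => z i) @^-1` B].

Definition streams : Type := g_sigma_algebraType cylinders.
HB.instance Definition _ := Measurable.on streams.

Lemma measurable_coord i : measurable_fun setT (fun z : streams => z i : L).
Proof.
move=> _ B mB; rewrite setTI; apply: sub_sigma_algebra.
by exists i, B.
Qed.

Lemma measurable_to_streams d (D : measurableType d) (f : D -> streams) :
  (forall i, measurable_fun setT (fun x => f x i : L)) -> measurable_fun setT f.
Proof.
move=> mf; apply: (@measurability _ _ D streams setT f cylinders) => //.
by move=> _ [_ [i [B [mB ->]]] <-]; exact: mf.
Qed.

Definition upd (z : streams) (i : I) (x : R) : streams :=
  fun j => if j == i then x else z j.

Lemma upd_eq z i x : upd z i x i = x. Proof. by rewrite /upd eqxx. Qed.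

Lemma upd_neq z i j x : j != i -> upd z i x j = z j.
Proof. by rewrite /upd => /negbTE ->. Qed.

Definition relabel (s : I -> I) (z : streams) : streams := fun i => z (s i).

Lemma measurable_upd d (D : measurableType d) (z : D -> streams) i (x : D -> L) :
  measurable_fun setT z -> measurable_fun setT x ->
  measurable_fun setT (fun w => upd (z w) i (x w)).
Proof.
move=> mz mx; apply: measurable_to_streams => j; rewrite /upd.
case: (j == i) => //.
exact: (measurableT_comp (measurable_coord j) mz).
Qed.

Definition product_law (Q : set streams -> \bar R) (mu : I -> probability L R) :=
  forall (k : nat) (i : 'I_k -> I) (B : 'I_k -> set L), injective i ->
    (forall l, measurable (B l)) ->
    Q (\bigcap_(l in [set: 'I_k]) [set z : streams | B l (z (i l))]) =
    (\prod_(l < k) mu (i l) (B l))%E.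

End streams.
Arguments streams {R} I.

Section product_law.
Context {R : realType} (I : eqType).
Notation L := (measurableTypeR R).
Implicit Types (mu : I -> probability L R).

(** The product rule determines the measure, because finite-dimensional
    rectangles form a generating family stable under intersection.  All the
    symmetries of the input variables below are obtained from this lemma. *)
Lemma product_law_unique (Q Q' : {measure set (@streams R I) -> \bar R}) mu :
  product_law Q mu -> product_law Q' mu ->
  forall A, measurable A -> Q A = Q' A.
Proof.
move=> QP QP'.
pose rect (J : seq I) (B : I -> set L) : set (streams I) :=
  [set z | forall i, i \in J -> B i (z i)].
pose G : set (set (streams I)) := [set A | exists J B,
  (forall i, measurable (B i)) /\ A = rect J B].
have mrect J B : (forall i, measurable (B i)) -> measurable (rect J B).
  move=> mB; rewrite (_ : rect J B = \big[setI/setT]_(i <- J)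
      ((fun z : streams I => z i) @^-1` B i)).
    apply: bigsetI_measurable => i _.
    by rewrite -[X in measurable X]setTI; exact: measurable_coord.
  apply/seteqP; split => z; elim: J => [|j J IH] //.
  - by move=> _; rewrite big_nil.
  - move=> zJ; rewrite big_cons; split; first by apply: zJ; rewrite mem_head.
    by apply: IH => i iJ; apply: zJ; rewrite in_cons iJ orbT.
  - rewrite big_cons => -[zj /IH zJ] i; rewrite in_cons => /predU1P[->//|].
    exact: zJ.
have rectE J B (Q0 : {measure set (streams I) -> \bar R}) :
    product_law Q0 mu -> (forall i, measurable (B i)) ->
    Q0 (rect J B) = (\prod_(i <- undup J) mu i (B i))%E.
  move=> Q0P mB.
  transitivity (Q0 (\bigcap_(l in [set: 'I_(size (undup J))])
      [set z : streams I | B (tnth (in_tuple (undup J)) l)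
                             (z (tnth (in_tuple (undup J)) l))])).
    congr (Q0 _); apply/seteqP; split => z /= zJ.
      by move=> l _; apply: zJ; rewrite -mem_undup mem_tnth.
    move=> i; rewrite -mem_undup => iJ.
    have /tnthP[l ->] : i \in in_tuple (undup J) by [].
    exact: zJ.
  have tnth_inj : injective (tnth (in_tuple (undup J))).
    by apply/tuple_uniqP; exact: undup_uniq.
  apply: etrans (Q0P _ _ (fun l => B (tnth (in_tuple (undup J)) l)) tnth_inj _) _.
    by move=> l; exact: mB.
  by rewrite (big_tnth _ _ (undup J)).
apply: (@measure_unique _ R _ G (fun=> setT)).
- apply/seteqP; split.
    apply: smallest_sub; first exact: smallest_sigma_algebra.
    move=> _ [i [B [mB ->]]]; apply: sub_sigma_algebra.
    exists [:: i], (fun=> B); split => //; apply/seteqP; split => z /=.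
      by move=> zB j; rewrite inE => /eqP ->.
    by move=> /(_ i); apply; rewrite mem_head.
  apply: smallest_sub; first exact: sigma_algebra_measurable.
  by move=> _ [J [B [mB ->]]]; exact: mrect.
- move=> _ _ [J [B [mB ->]]] [J' [B' [mB' ->]]].
  (* a coordinate constrained by only one of the two rectangles is free in the
     other one *)
  exists (J ++ J'), (fun i => (if i \in J then B i else setT) `&`
                              (if i \in J' then B' i else setT)); split.
    by move=> i; apply: measurableI; case: ifP.
  apply/seteqP; split => z /=.
    move=> [zJ zJ'] i _; split; case: ifP => //; [exact: zJ|exact: zJ'].
  move=> zJJ; split => i iJ.
    by have := zJJ i; rewrite mem_cat iJ => /(_ isT)[].
  by have := zJJ i; rewrite mem_cat iJ orbT => /(_ isT)[].
- by move=> _; exists [::], (fun=> setT); split => //; apply/seteqP; split.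
- by apply/seteqP; split => // z _; exists 0%N.
- by move=> _ [J [B [mB ->]]]; rewrite !rectE.
- move=> _; have -> : setT = rect [::] (fun=> setT) by apply/seteqP; split.
  by rewrite rectE// big_nil ltry.
Qed.

End product_law.

Section independent_coordinates.
Context {R : realType} (I : eqType).
Notation L := (measurableTypeR R).
Variables (mu : I -> probability L R) (Q : probability (@streams R I) R).
Hypothesis QP : product_law Q mu.
Implicit Types (A : set (@streams R I)) (z : @streams R I).

Lemma measurable_preimage_upd i (A : set (@streams R I)) : measurable A ->
  measurable [set xz : L * @streams R I | A (upd xz.2 i xz.1)].
Proof.
move=> mA.
have mf : measurable_fun setT (fun xz : L * @streams R I => upd xz.2 i xz.1).
  by apply: measurable_upd.
by rewrite -[X in measurable X]setTI; exact: mf.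
Qed.

Lemma product_law_relabel (s : I -> I) A : injective s ->
  (forall i, mu (s i) = mu i) -> measurable A -> Q [set z | A (relabel s z)] = Q A.
Proof.
move=> s_inj mus mA.
have ms : measurable_fun setT (@relabel R I s).
  by apply: measurable_to_streams => i; exact: measurable_coord.
transitivity (image_measure Q ms A) => //.
apply: product_law_unique mA => // k i B i_inj mB.
transitivity (\prod_(l < k) mu (s (i l)) (B l))%E; last first.
  by apply: eq_bigr => l _; rewrite mus.
by apply: (QP (i := s \o i)) => //; exact: inj_comp.
exact: QP.
Qed.

(** Fubini's theorem for one coordinate: replacing the coordinate i by an
    independent draw x leaves the law unchanged, because the image of
    [mu i \x Q] under [upd] satisfies the same product rule. *)
Lemma resample i A : measurable A ->
  Q A = (\int[mu i]_x Q [set z | A (upd z i x)])%E.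
Proof.
move=> mA.
have mf : measurable_fun setT (fun xz : L * @streams R I => upd xz.2 i xz.1).
  by apply: measurable_upd.
transitivity (image_measure (mu i \x Q)%E mf A); last first.
  by apply: eq_integral => x _ /=; congr (Q _); apply/seteqP; split => z /=;
    rewrite /xsection/= inE.
apply: product_law_unique QP _ _ mA => k j B j_inj mB.
(* the constraint on the coordinate i, if there is one, bears on x alone *)
pose B' l := if j l == i then setT else B l.
pose C := [set x : L | forall l, j l = i -> B l x].
transitivity ((mu i \x Q)%E (C `*` \bigcap_(l in [set: 'I_k])
    [set z : streams I | B' l (z (j l))])).
  congr ((_ \x _)%E _); apply/seteqP; split => -[x z] /=.
    move=> xz; split=> [l jl|l _] /=; have := xz l Logic.I; rewrite /= /upd.
      by rewrite jl eqxx.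
    by rewrite /B'; case: eqP.
  move=> [Cx zB] l _ /=; have := zB l Logic.I; rewrite /= /upd /B'; case: eqP => // jl _.
  exact: Cx.
have mB' l : measurable (B' l) by rewrite /B'; case: ifP.
have mrect : measurable (\bigcap_(l in [set: 'I_k])
    [set z : streams I | B' l (z (j l))]).
  apply: fin_bigcap_measurable => // l _.
  by rewrite -[X in measurable X]setTI; exact: (measurable_coord (j l)).
have rectE : measurable C -> (mu i \x Q)%E (C `*` \bigcap_(l in [set: 'I_k])
    [set z : streams I | B' l (z (j l))]) =
    (mu i C * \prod_(l < k) mu (j l) (B' l))%E.
  by move=> mC; rewrite product_measure1E//; congr (_ * _)%E; exact: QP.
have [[l0 jl0]|jNi] := pselect (exists l0, j l0 = i).
  have CE : C = B l0.
    apply/seteqP; split => x; first by apply.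
    by move=> Bx l jl; rewrite (j_inj l l0)// jl.
  rewrite rectE CE// (bigD1 l0)//= /B' jl0 eqxx probability_setT mul1e.
  rewrite [RHS](bigD1 l0)//= jl0; congr (_ * _)%E.
  apply: eq_bigr => l ll0; case: eqP => // jl.
  by rewrite (j_inj l l0) ?eqxx// jl in ll0.
have CE : C = setT by apply/seteqP; split => // x _ l jl; case: jNi; exists l.
rewrite rectE CE// probability_setT mul1e.
by apply: eq_bigr => l _; rewrite /B'; case: eqP => // jl; case: jNi; exists l.
Qed.

Lemma measurable_resample i A : measurable A ->
  measurable_fun setT (fun x : L => Q [set z | A (upd z i x)]).
Proof.
move=> mA.
rewrite (_ : (fun _ => _) =
  Q \o xsection [set xz : L * @streams R I | A (upd xz.2 i xz.1)]).
  exact: (measurable_fun_xsection Q (measurable_preimage_upd i mA)).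
by apply/funext => x /=; congr (Q _); apply/seteqP; split => z;
  rewrite /xsection/= inE.
Qed.

(** Invariance of A under changes of the coordinate i is the form in which
    independence of that coordinate from A is available for path events. *)
Lemma independent_coord i (B : set L) A : measurable B -> measurable A ->
  (forall z x, A (upd z i x) <-> A z) ->
  Q ([set z | B (z i)] `&` A) = (mu i B * Q A)%E.
Proof.
move=> mB mA invA.
have mBi : measurable [set z : streams I | B (z i)].
  by rewrite -[X in measurable X]setTI; exact: (measurable_coord i).
rewrite (resample i); last exact: measurableI.
transitivity (\int[mu i]_x (Q A * (\1_B x)%:E))%E.
  apply: eq_integral => x _; rewrite indicE.
  have [xB|xB] := boolP (x \in B); rewrite /= ?mule1 ?mule0.
    congr (Q _); apply/seteqP; split => z /=; rewrite invA /upd eqxx.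
      by case.
    by move=> Az; split => //; rewrite -in_setE.
  rewrite (_ : mkset _ = set0) ?measure0//; apply/seteqP; split => z //=.
  by rewrite /upd eqxx => -[Bx _]; move: xB; rewrite mem_set.
rewrite ge0_integralZl//; last by exact/measurable_EFinP.
by rewrite integral_indic// setIT muleC.
Qed.

Lemma measurable_memoryless_coord i b (u : R) A : measurable A ->
  measurable [set z : @streams R I | z i \in Interval (BSide b u) +oo%O /\ A (upd z i (z i - u))].
Proof.
move=> mA; have mcoord := @measurable_coord R I i.
apply: measurableI.
  suff : measurable ((fun z : @streams R I => z i) @^-1`
    [set` Interval (BSide b u) +oo%O]) by [].
  by rewrite -[X in measurable X]setTI; apply: mcoord => //; exact: measurable_itv.
rewrite -[X in measurable X]setTI; apply: (_ : measurable_fun setT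
  (fun z : streams I => upd z i (z i - u))) => //.
by apply: measurable_upd => //; exact: measurable_funB.
Qed.

(** Given that the coordinate i exceeds u, its excess over u has the original
    law and remains independent of the other coordinates. *)
Lemma memoryless_coord rate (rate_gt0 : 0 < rate) i b u A :
  mu i = exp_law rate_gt0 -> 0 <= u -> measurable A ->
  Q [set z | z i \in Interval (BSide b u) +oo%O /\ A (upd z i (z i - u))] =
  ((expR (- rate * u))%:E * Q A)%E.
Proof.
move=> mui u0 mA; pose D : set L := [set` Interval (BSide b u) +oo%O].
have mD : measurable D by exact: measurable_itv.
rewrite (resample i); last exact: measurable_memoryless_coord.
pose h x := Q [set z | A (upd z i x)].
transitivity (\int[mu i]_(x in D) h (x - u)%R)%E.
  rewrite [RHS]integral_mkcond; apply: eq_integral => x _.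
  rewrite patchE; case: ifPn => xD.
    congr (Q _); apply/seteqP; split => z /=.
      by move=> [_]; congr A; apply/funext => j; rewrite /upd eqxx; case: eqP.
    move=> Az; split; first by rewrite /upd eqxx; move: xD; rewrite inE.
    by move: Az; congr A; apply/funext => j; rewrite /upd eqxx; case: eqP.
  rewrite (_ : mkset _ = set0) ?measure0//; apply/seteqP; split => z //=.
  by rewrite /upd eqxx => -[Dx _]; move: xD; rewrite mem_set.
rewrite mui integral_exp_law_memoryless//; last exact: measurable_resample.
by rewrite (resample i)// mui.
Qed.

Lemma resample_pos rate (rate_gt0 : 0 < rate) i A :
  mu i = exp_law rate_gt0 -> measurable A ->
  Q A = (\int[exp_law rate_gt0]_(x in `]0%R, +oo[) Q [set z | A (upd z i x)])%E.
Proof.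
move=> mui mA; rewrite (resample i)// mui.
by apply: (integral_exp_law_pos _ false) => //; exact: measurable_resample.
Qed.

Definition shift_on (J : seq I) (u : R) z : @streams R I :=
  fun i => if i \in J then z i - u else z i.

Lemma measurable_shift_on J u : measurable_fun setT (shift_on J u).
Proof.
apply: measurable_to_streams => i; rewrite /shift_on.
have mi := @measurable_coord R I i.
by case: (i \in J) => //; exact: measurable_funB.
Qed.

Lemma measurable_gt_on (J : seq I) (u : R) :
  measurable [set z : @streams R I | forall j, j \in J -> u < z j].
Proof.
rewrite (_ : mkset _ = \big[setI/setT]_(j <- J)
    ((fun z : @streams R I => z j) @^-1` `]u, +oo[)).
  apply: bigsetI_measurable => j _.
  by rewrite -[X in measurable X]setTI; exact: (@measurable_coord R I j).
apply/seteqP; split => z; elim: J => [|j J IH] //.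
- by move=> _; rewrite big_nil.
- move=> zJ; rewrite big_cons; split.
    by rewrite /= in_itv/= andbT; apply: zJ; rewrite mem_head.
  by apply: IH => k kJ; apply: zJ; rewrite in_cons kJ orbT.
- rewrite big_cons => -[/=]; rewrite in_itv/= andbT => zj /IH zJ k.
  by rewrite in_cons => /predU1P[->//|]; exact: zJ.
Qed.

(** The same for several coordinates of mean 1 at once: a completion or an
    arrival after each customer has received the amount u of service leaves
    fresh remaining requirements. *)
Lemma memoryless_coords (J : seq I) (u : R) A : uniq J ->
  (forall i, i \in J -> mu i = exp_law (@ltr01 R)) -> 0 <= u -> measurable A ->
  Q [set z | (forall i, i \in J -> u < z i) /\ A (shift_on J u z)] =
  ((expR (- (size J)%:R * u))%:E * Q A)%E.
Proof.
move=> + + u0; elim: J A => [|i J IH] A.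
  move=> _ _ mA; rewrite /= mulr0n oppr0 mul0r expR0 mul1e.
  by congr (Q _); apply/seteqP; split => z /= => [[]|Az]; last split.
move=> /= /andP[iJ uJ] muJ mA.
pose A' : set (@streams R I) := [set z | (forall j, j \in J -> u < z j) /\ A (shift_on J u z)].
have mA' : measurable A'.
  apply: measurableI; first exact: measurable_gt_on.
  by rewrite -[X in measurable X]setTI; exact: measurable_shift_on.
transitivity (Q [set z | z i \in Interval (BSide false u) +oo%O /\
                         A' (upd z i (z i - u))]).
  congr (Q _); apply/seteqP; split => z /=; rewrite in_itv/= andbT.
    move=> [zJ Az]; split; first by apply: zJ; rewrite mem_head.
    split=> [j jJ|].
      rewrite /upd; case: eqP => [ji|_]; first by rewrite -ji jJ in iJ.
      by apply: zJ; rewrite in_cons jJ orbT.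
    move: Az; congr A; apply/funext => j; rewrite /shift_on /upd in_cons.
    by case: eqP => // ->; rewrite (negbTE iJ).
  move=> [ui [zJ Az]]; split=> [j|].
    rewrite in_cons => /predU1P[->//|jJ].
    have := zJ j jJ; rewrite /upd; case: eqP => // ji _.
    by rewrite ji.
  move: Az; congr A; apply/funext => j; rewrite /shift_on /upd in_cons.
  by case: eqP => // ->; rewrite (negbTE iJ).
rewrite (memoryless_coord _ (muJ i (mem_head _ _)))// IH//; last first.
  by move=> j jJ; apply: muJ; rewrite in_cons jJ orbT.
rewrite muleA -EFinM -expRD; congr ((expR _)%:E * _)%E.
by rewrite -(natr1 (size J)); ring.
Qed.

Lemma no_tie rate (rate_gt0 : 0 < rate) i j : mu i = exp_law rate_gt0 ->
  i != j -> Q [set z | z i = z j] = 0%E.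
Proof.
move=> mui ij.
have mij : measurable [set z : @streams R I | z i = z j].
  rewrite (_ : mkset _ = (fun z : @streams R I => z i == z j) @^-1` [set true]).
    rewrite -[X in measurable X]setTI; apply: (_ : measurable_fun setT
      (fun z : @streams R I => z i == z j)) => //.
    by apply: measurable_fun_eqr; exact: measurable_coord.
  by apply/seteqP; split => z /= /eqP.
rewrite (resample j)// integral0_eq// => x _.
transitivity (Q ([set z | [set x] (z i)] `&` setT)).
  congr (Q _); apply/seteqP; split => z /=; rewrite /upd eqxx (negbTE ij) ?inE//.
  by case.
by rewrite independent_coord// mui exp_law_set1 mul0e.
Qed.

End independent_coordinates.

(** * Measurability of the sample paths *)

Section measurable_dynamics.
Context {R : realType} d (D : measurableType d).
Notation L := (measurableTypeR R).

Lemma measurable_to_nat (N : D -> nat) :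
  (forall n, measurable [set x | N x = n]) -> measurable_fun setT N.
Proof.
move=> mN _ B _; rewrite setTI (_ : _ @^-1` _ =
    \bigcup_(n in B) [set x | N x = n]).
  exact: bigcup_measurable.
apply/seteqP; split => x /=; first by move=> BN; exists (N x).
by move=> [n Bn /= ->].
Qed.

(** States contain natural numbers and lists of varying length: each of their
    operations is measurable because it is so for every fixed value of the
    discrete part. *)
Lemma measurable_glue d' (E : measurableType d') (N : D -> nat) (f : nat -> D -> E) :
  measurable_fun setT N -> (forall n, measurable_fun setT (f n)) ->
  measurable_fun setT (fun x => f (N x) x).
Proof.
move=> mN mf _ B mB; rewrite setTI (_ : _ @^-1` _ =
    \bigcup_n (N @^-1` [set n] `&` f n @^-1` B)).
  apply: bigcup_measurable => n _; apply: measurableI.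
    by rewrite -[X in measurable X]setTI; exact: mN.
  by rewrite -[X in measurable X]setTI; exact: mf.
apply/seteqP; split => x /=; first by move=> BN; exists (N x).
by move=> [n _ [/= -> ]].
Qed.

Lemma measurable_natfun d' (E : measurableType d') (N : D -> nat) (g : nat -> E) :
  measurable_fun setT N -> measurable_fun setT (fun x => g (N x)).
Proof. by move=> mN; apply: (@measurable_glue _ _ N (fun n _ => g n)). Qed.

(** The sigma-algebra of the disjoint union of the powers of the line:
    reading beyond the end gives a constant. *)
Definition measurable_seq (s : D -> seq R) :=
  measurable_fun setT (fun x => size (s x)) /\
  forall i, measurable_fun setT (fun x => nth 0 (s x) i : L).

Lemma mkseqE (f : nat -> R) n : mkseq f n.+1 = f 0%N :: mkseq (fun i => f i.+1) n.
Proof.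
by rewrite /mkseq /= (iotaDl 1 0) -map_comp.
Qed.

(** Reduction to lists of a fixed length n, where a function of the list is a
    function of n measurable coordinates. *)
Lemma measurable_seq_fun d' (E : measurableType d') (s : D -> seq R)
    (H : D -> seq R -> E) : measurable_seq s ->
  (forall n (f : nat -> D -> L), (forall i, measurable_fun setT (f i)) ->
     measurable_fun setT (fun x => H x (mkseq (f ^~ x) n))) ->
  measurable_fun setT (fun x => H x (s x)).
Proof.
move=> [ms ns] mH.
rewrite (_ : (fun _ => _) = fun x => H x (mkseq (nth 0 (s x)) (size (s x)))).
  apply: (@measurable_glue _ _ (fun x => size (s x))
    (fun n x => H x (mkseq (nth 0 (s x)) n))) => // n.
  exact: (mH n (fun i x => nth 0 (s x) i)).
by apply/funext => x; rewrite mkseq_nth.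
Qed.

Lemma measurable_seq_seq (s : D -> seq R) (H : D -> seq R -> seq R) :
  measurable_seq s ->
  (forall n (f : nat -> D -> L), (forall i, measurable_fun setT (f i)) ->
     measurable_seq (fun x => H x (mkseq (f ^~ x) n))) ->
  measurable_seq (fun x => H x (s x)).
Proof.
move=> ms mH; split=> [|i].
  apply: (@measurable_seq_fun _ _ s (fun x u => size (H x u))) => // n f mf.
  by case: (mH n f mf).
apply: (@measurable_seq_fun _ _ s (fun x u => nth 0 (H x u) i : L)) => // n f mf.
by case: (mH n f mf) => _; exact.
Qed.

Lemma measurable_seq_nil : measurable_seq (fun _ => [::]).
Proof. by split => // i; under eq_fun do rewrite nth_nil; exact: measurable_cst. Qed.

Lemma measurable_seq_cons (f : D -> L) (s : D -> seq R) :
  measurable_fun setT f -> measurable_seq s -> measurable_seq (fun x => f x :: s x).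
Proof.
move=> mf [ms ns]; split=> [|[|i]] //=.
exact: (@measurable_natfun _ _ _ succn ms).
Qed.

Lemma measurable_seq_if (c : D -> bool) (s u : D -> seq R) :
  measurable_fun setT c -> measurable_seq s -> measurable_seq u ->
  measurable_seq (fun x => if c x then s x else u x).
Proof.
move=> mc [ms ns] [mu nu]; split=> [|i].
  by under eq_fun do rewrite (fun_if size); exact: measurable_fun_ifT.
under eq_fun do rewrite (fun_if (fun v => nth 0 v i)).
exact: measurable_fun_ifT.
Qed.

Lemma measurable_seq_mkseq n (f : nat -> D -> L) :
  (forall i, measurable_fun setT (f i)) -> measurable_seq (fun x => mkseq (f ^~ x) n).
Proof.
elim: n f => [|n IH] f mf; first exact: measurable_seq_nil.
under eq_fun do rewrite mkseqE.
by apply: measurable_seq_cons => //; exact: (IH (fun i => f i.+1)).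
Qed.

Lemma measurable_seq_rcons (s : D -> seq R) (f : D -> L) :
  measurable_seq s -> measurable_fun setT f -> measurable_seq (fun x => rcons (s x) (f x)).
Proof.
move=> ms mf; apply: (@measurable_seq_seq s (fun x u => rcons u (f x))) => // n g.
elim: n g => [|n IH] g mg.
  by apply: measurable_seq_cons => //; exact: measurable_seq_nil.
under eq_fun do rewrite mkseqE /=.
by apply: measurable_seq_cons => //; exact: (IH (fun i => g i.+1)).
Qed.

Lemma measurable_seq_sub (s : D -> seq R) (f : D -> L) :
  measurable_seq s -> measurable_fun setT f ->
  measurable_seq (fun x => [seq v - f x | v <- s x]).
Proof.
move=> ms mf; apply: (@measurable_seq_seq s (fun x u => [seq v - f x | v <- u])) => // n g.
elim: n g => [|n IH] g mg; first exact: measurable_seq_nil.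
under eq_fun do rewrite mkseqE /=.
apply: measurable_seq_cons; last exact: (IH (fun i => g i.+1)).
exact: (measurable_funB (mg 0%N) mf).
Qed.

Lemma measurable_seq_gt (s : D -> seq R) (f : D -> L) :
  measurable_seq s -> measurable_fun setT f ->
  measurable_seq (fun x => [seq v <- s x | f x < v]).
Proof.
move=> ms mf; apply: (@measurable_seq_seq s (fun x u => [seq v <- u | f x < v])) => // n g.
elim: n g => [|n IH] g mg; first exact: measurable_seq_nil.
under eq_fun do rewrite mkseqE /=.
have IHg := IH (fun i => g i.+1) (fun i => mg i.+1).
apply: measurable_seq_if => //; first exact: (measurable_fun_ltr mf (mg 0%N)).
exact: measurable_seq_cons.
Qed.

Lemma measurable_bigmin (s : D -> seq R) (f : D -> L) :
  measurable_seq s -> measurable_fun setT f ->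
  measurable_fun setT (fun x => \big[Num.min/f x]_(v <- s x) v : L).
Proof.
move=> ms mf.
apply: (@measurable_seq_fun _ _ s (fun x u => \big[Num.min/f x]_(v <- u) v)) => // n g.
elim: n g => [|n IH] g mg; first by under eq_fun do rewrite /mkseq big_nil.
under eq_fun do rewrite mkseqE big_cons.
have IHg := IH (fun i => g i.+1) (fun i => mg i.+1).
exact: (measurable_minr (mg 0%N) IHg).
Qed.

Lemma measurable_seq_drop1 (s : D -> seq R) (N : D -> nat) :
  measurable_seq s -> measurable_fun setT N ->
  measurable_seq (fun x => take (N x) (s x) ++ drop (N x).+1 (s x)).
Proof.
move=> ms mN; apply: (@measurable_seq_seq s
  (fun x u => take (N x) u ++ drop (N x).+1 u)) => // n g mg.
suff fixN k : measurable_seq (fun x =>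
    take k (mkseq (g ^~ x) n) ++ drop k.+1 (mkseq (g ^~ x) n)).
  split=> [|i]; last first.
    by apply: (@measurable_glue _ L N (fun k x => nth 0 (take k (mkseq (g ^~ x) n) ++
      drop k.+1 (mkseq (g ^~ x) n)) i)) => // k; case: (fixN k) => _; exact.
  by apply: (@measurable_glue _ _ N (fun k x => size (take k (mkseq (g ^~ x) n) ++
    drop k.+1 (mkseq (g ^~ x) n)))) => // k; case: (fixN k).
elim: n k g mg => [|n IH] k g mg; first exact: measurable_seq_nil.
under eq_fun do rewrite mkseqE.
case: k => [|k] /=.
  by under eq_fun do rewrite drop0; apply: (@measurable_seq_mkseq n (fun i => g i.+1)).
by apply: measurable_seq_cons => //; exact: (IH k (fun i => g i.+1)).
Qed.

Lemma measurable_nth_glue (s : D -> seq R) (N : D -> nat) :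
  measurable_seq s -> measurable_fun setT N ->
  measurable_fun setT (fun x => nth 0 (s x) (N x) : L).
Proof.
by move=> [_ ns] mN; apply: (@measurable_glue _ _ N (fun n x => nth 0 (s x) n)).
Qed.

Lemma truncn_eqE (x : R) n :
  (Num.truncn x == n) = ((n == 0)%N || (n%:R <= x)) && ~~ (n.+1%:R <= x).
Proof.
rewrite eqn_leq -!truncn_gt_nat -leqNgt andbC; congr (_ && _).
by case: n => // n; rewrite -truncn_gt_nat.
Qed.

Lemma measurable_truncn (f : D -> L) : measurable_fun setT f ->
  measurable_fun setT (fun x => Num.truncn (f x)).
Proof.
move=> mf; apply: measurable_to_nat => n.
rewrite (_ : mkset _ = (fun x =>
    ((n == 0)%N || (n%:R <= f x)) && ~~ (n.+1%:R <= f x)) @^-1` [set true]).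
  rewrite -[X in measurable X]setTI.
  suff mb : measurable_fun setT (fun x =>
    ((n == 0)%N || (n%:R <= f x)) && ~~ (n.+1%:R <= f x)) by exact: mb.
  apply: measurable_and; first apply: measurable_or => //.
    exact: measurable_fun_ler.
  by apply: measurable_neg; exact: measurable_fun_ler.
by apply/seteqP; split => x /=; rewrite -truncn_eqE => /eqP.
Qed.

Definition ps_measurable (st : D -> ps_state (R := R)) :=
  [/\ measurable_fun setT (fun x => ps_clock (st x) : L),
      measurable_fun setT (fun x => ps_tagged (st x) : L),
      measurable_seq (fun x => ps_others (st x)),
      measurable_fun setT (fun x => ps_next (st x) : L) &
      measurable_fun setT (fun x => ps_arrival (st x))].

Lemma ps_measurable_if (c : D -> bool) (s u : D -> ps_state) :
  measurable_fun setT c -> ps_measurable s -> ps_measurable u ->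
  ps_measurable (fun x => if c x then s x else u x).
Proof.
move=> mc [s1 s2 s3 s4 s5] [u1 u2 u3 u4 u5]; split.
- by under eq_fun do rewrite (fun_if (@ps_clock R)); exact: measurable_fun_ifT.
- by under eq_fun do rewrite (fun_if (@ps_tagged R)); exact: measurable_fun_ifT.
- by under eq_fun do rewrite (fun_if (@ps_others R)); exact: measurable_seq_if.
- by under eq_fun do rewrite (fun_if (@ps_next R)); exact: measurable_fun_ifT.
- by under eq_fun do rewrite (fun_if (@ps_arrival R)); exact: measurable_fun_ifT.
Qed.

Definition ros_measurable (st : D -> ros_state (R := R)) :=
  [/\ measurable_fun setT (fun x => ros_clock (st x) : L),
      measurable_fun setT (fun x => ros_started (st x)),
      measurable_fun setT (fun x => ros_server (st x) : L),
      measurable_seq (fun x => ros_waiting (st x)) &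
     [/\ measurable_fun setT (fun x => ros_next (st x) : L),
      measurable_fun setT (fun x => ros_arrival (st x)) &
      measurable_fun setT (fun x => ros_completion (st x))]].

Lemma ros_measurable_if (c : D -> bool) (s u : D -> ros_state) :
  measurable_fun setT c -> ros_measurable s -> ros_measurable u ->
  ros_measurable (fun x => if c x then s x else u x).
Proof.
move=> mc [s1 s2 s3 s4 [s5 s6 s7]] [u1 u2 u3 u4 [u5 u6 u7]]; split; last split.
- by under eq_fun do rewrite (fun_if (@ros_clock R)); exact: measurable_fun_ifT.
- by under eq_fun do rewrite (fun_if (@ros_started R)); exact: measurable_fun_ifT.
- by under eq_fun do rewrite (fun_if (@ros_server R)); exact: measurable_fun_ifT.
- by under eq_fun do rewrite (fun_if (@ros_waiting R)); exact: measurable_seq_if.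
- by under eq_fun do rewrite (fun_if (@ros_next R)); exact: measurable_fun_ifT.
- by under eq_fun do rewrite (fun_if (@ros_arrival R)); exact: measurable_fun_ifT.
- by under eq_fun do rewrite (fun_if (@ros_completion R)); exact: measurable_fun_ifT.
Qed.

Section steps.
Variables (b : nat -> R) (gap work mark pick : D -> nat -> R).
Hypothesis mgap : forall j, measurable_fun setT (fun x => gap x j : L).
Hypothesis mwork : forall j, measurable_fun setT (fun x => work x j : L).
Hypothesis mmark : forall j, measurable_fun setT (fun x => mark x j : L).
Hypothesis mpick : forall j, measurable_fun setT (fun x => pick x j : L).

Lemma ps_measurable_step (st : D -> ps_state) : ps_measurable st ->
  ps_measurable (fun x => ps_step b (gap x) (work x) (mark x) (st x)).
Proof.
move=> mst; have [mc mt [ms ns] mn ma] := mst.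
have mo : measurable_seq (fun x => ps_others (st x)) by [].
pose k x : R := (size (ps_others (st x))).+1%:R.
have mk : measurable_fun setT (k : D -> L).
  exact: (@measurable_natfun _ L _ (fun n => n.+1%:R : R) ms).
have mkV : measurable_fun setT (fun x => (k x)^-1 : L).
  exact: (@measurable_natfun _ L _ (fun n => n.+1%:R^-1 : R) ms).
have mr := measurable_bigmin mo mt.
have mak : measurable_fun setT (fun x => ps_next (st x) / k x : L).
  exact: measurable_funM.
have mkr := measurable_funM mk mr.
apply: ps_measurable_if => //; first exact: measurable_fun_ler.
apply: ps_measurable_if; first exact: measurable_fun_ler.
  split => //=.
  - exact: measurable_funD.
  - exact: measurable_funB.
  - by apply: measurable_seq_sub => //; exact: measurable_seq_gt.
  - exact: measurable_funB.
have mgl (f : D -> nat -> R) : (forall j, measurable_fun setT (fun x => f x j : L)) ->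
    measurable_fun setT (fun x => f x (ps_arrival (st x)) : L).
  by move=> mf; apply: (@measurable_glue _ _ _ (fun j x => f x j)).
split => //=.
- exact: measurable_funD.
- exact: measurable_funB.
- have msub := measurable_seq_sub mo mak.
  apply: measurable_seq_if.
  + apply: measurable_fun_ltr; first exact: mgl.
    exact: (@measurable_natfun _ L _ (fun n => b n.+1) ms).
  + by apply: measurable_seq_rcons => //; exact: mgl.
  + exact: msub.
- exact: mgl.
- exact: (@measurable_natfun _ _ _ succn ma).
Qed.

Lemma ps_measurable_iter m (st : D -> ps_state) : ps_measurable st ->
  ps_measurable (fun x => iter m (ps_step b (gap x) (work x) (mark x)) (st x)).
Proof. by move=> mst; elim: m => //= m; exact: ps_measurable_step. Qed.

Lemma ros_measurable_step (st : D -> ros_state) : ros_measurable st ->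
  ros_measurable (fun x => ros_step b (gap x) (work x) (mark x) (pick x) (st x)).
Proof.
move=> mst; have [mc mt mv mw [mn ma mco]] := mst.
have [ms ns] := mw.
have mgl (f : D -> nat -> R) : (forall j, measurable_fun setT (fun x => f x j : L)) ->
    measurable_fun setT (fun x => f x (ros_arrival (st x)) : L).
  by move=> mf; apply: (@measurable_glue _ _ _ (fun j x => f x j)).
pose N x := Num.truncn (pick x (ros_completion (st x)) *
                        (size (ros_waiting (st x))).+1%:R).
have mN : measurable_fun setT N.
  apply: measurable_truncn; apply: measurable_funM.
    exact: (@measurable_glue _ L _ (fun j x => pick x j)).
  exact: (@measurable_natfun _ L _ (fun n => n.+1%:R : R) ms).
have mclock := measurable_funD mc mv.
have mnext := measurable_funB mn mv.
have mcS := @measurable_natfun _ _ _ succn mco.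
have maS := @measurable_natfun _ _ _ succn ma.
apply: ros_measurable_if => //.
apply: ros_measurable_if; first exact: measurable_fun_ler.
- rewrite (_ : (fun _ => _) = fun x => if N x == 0%N then
      ROSState (ros_clock (st x) + ros_server (st x)) true (work x 0%N)
        (ros_waiting (st x)) (ros_next (st x) - ros_server (st x))
        (ros_arrival (st x)) (ros_completion (st x)).+1
    else ROSState (ros_clock (st x) + ros_server (st x)) false
        (nth 0 (ros_waiting (st x)) (N x).-1)
        (take (N x).-1 (ros_waiting (st x)) ++ drop (N x).-1.+1 (ros_waiting (st x)))
        (ros_next (st x) - ros_server (st x))
        (ros_arrival (st x)) (ros_completion (st x)).+1); last first.
    by apply/funext => x; rewrite -/(N x); case: (N x).
  have mNP := @measurable_natfun _ _ _ predn mN.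
  apply: ros_measurable_if.
  + exact: (@measurable_natfun _ bool _ (fun n => n == 0%N) mN).
  + by split => //=; split => //=.
  + split => //=; first exact: measurable_nth_glue.
    exact: measurable_seq_drop1.
- split => //=; last split => //.
  + exact: measurable_funD.
  + exact: measurable_funB.
  + apply: measurable_seq_if => //.
      apply: measurable_fun_ltr; first exact: mgl.
      exact: (@measurable_natfun _ L _ (fun n => b n.+2) ms).
    by apply: measurable_seq_rcons => //; exact: mgl.
  + exact: mgl.
Qed.

Lemma ros_measurable_iter m (st : D -> ros_state) : ros_measurable st ->
  ros_measurable (fun x => iter m (ros_step b (gap x) (work x) (mark x) (pick x)) (st x)).
Proof. by move=> mst; elim: m => //= m; exact: ros_measurable_step. Qed.

End steps.

End measurable_dynamics.

(** * The common recursion *)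

Definition source_code (s : source) : nat * nat :=
  match s with
  | Defs.Found => (0, 0)
  | Residual i => (1, i)
  | Gap j => (2, j)
  | Work j => (3, j)
  | Mark j => (4, j)
  end%N.

Definition source_decode (p : nat * nat) : source :=
  match p with
  | (1, i) => Residual i
  | (2, j) => Gap j
  | (3, j) => Work j
  | (4, j) => Mark j
  | _ => Defs.Found
  end%N.

Lemma source_codeK : cancel source_code source_decode. Proof. by case. Qed.

HB.instance Definition _ := Equality.copy source (can_type source_codeK).

Section laws.
Context {R : realType}.
Notation L := (measurableTypeR R).
Variables (rho : R) (rho_gt0 : 0 < rho) (b : nat -> R) (t : R).

Definition queue_law (found_law : probability L R) (s : source) : probability L R :=
  match s with
  | Defs.Found => found_law
  | Residual _ | Work _ => exp_law (@ltr01 R)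
  | Gap _ => exp_law rho_gt0
  | Mark _ => uniform_prob (@ltr01 R)
  end.

Definition after_service (F : nat -> R -> \bar R) n (l : nat) (c : R) : \bar R :=
  if l is 0%N then (if c <= t then 1%E else 0%E) else F n.-1 c.

(** Both queues lead to this function: n is the number of competitors of the
    tagged customer, c the clock and m a bound on the number of events.  The
    first event is a completion at s if no arrival comes before s, with
    probability exp(- rho s), the completion concerning the tagged customer
    (l = 0) or one of the n others with the same probability; or an arrival at
    s if no completion comes before s, with probability exp(- s). *)
Fixpoint served_within (m n : nat) (c : R) : \bar R :=
  if m is m'.+1 then
    (\sum_(l < n.+1) ((n.+1%:R^-1)%:E *
      \int[exp_law (@ltr01 R)]_(s in `]0%R, +oo[)
        ((expR (- rho * s))%:E * after_service (served_within m') n l (c + s)))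
    + \int[exp_law rho_gt0]_(s in `]0%R, +oo[)
        ((expR (- s))%:E * ((b n.+1)%:E * served_within m' n.+1 (c + s) +
                            (1 - b n.+1)%:E * served_within m' n (c + s))))%E
  else 0%E.

Lemma served_within_ge0 m n c : (forall k, 0 <= b k <= 1) ->
  (0 <= served_within m n c)%E.
Proof.
move=> b01; elim: m n c => //= m IH n c; apply: adde_ge0.
  apply: sume_ge0 => l _; apply: mule_ge0; first by rewrite lee_fin invr_ge0.
  apply: integral_ge0 => s _; apply: mule_ge0; first by rewrite lee_fin expR_ge0.
  by rewrite /after_service; case: (nat_of_ord l) => //; case: ifP; rewrite ?lee01.
apply: integral_ge0 => s _; apply: mule_ge0; first by rewrite lee_fin expR_ge0.
have /andP[b0 b1] := b01 n.+1.
by apply: adde_ge0; apply: mule_ge0; rewrite // lee_fin ?subr_ge0.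
Qed.

End laws.

Section partition.
Context {R : realType} d (T : measurableType d) (Q : {measure set T -> \bar R}).

(** The cases of the first event are disjoint but exhaustive only up to a
    negligible set: equal requirements in processor sharing, a pick that is not
    below 1 in random order of service. *)
Lemma measure_partition k (D : 'I_k -> set T) (N A : set T) :
  measurable A -> (forall l, measurable (D l)) -> Q.-negligible N ->
  (forall l l' x, D l x -> D l' x -> l = l') ->
  (forall x, A x -> N x \/ exists l, D l x) ->
  Q A = (\sum_(l < k) Q (A `&` D l))%E.
Proof.
move=> mA mD QN Ddisj cov.
pose U := \big[setU/set0]_(l < k) (A `&` D l).
have mAD l : measurable (A `&` D l) by exact: measurableI.
have mU : measurable U by exact: bigsetU_measurable.
have UE x : U x <-> A x /\ exists l, D l x.
  rewrite /U -bigcup_seq /=; split=> [[l _ [Ax Dlx]]|[Ax [l Dlx]]].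
    by split => //; exists l.
  by exists l => //=; rewrite mem_index_enum.
have UA : U `<=` A by move=> x /UE[].
have QAU : Q (A `\` U) = 0%E.
  apply: measure_negligible; first exact: measurableD.
  apply: negligibleS QN => x [Ax nUx]; have [//|Dx] := cov x Ax.
  by case: nUx; apply/UE.
transitivity (Q U + Q (A `\` U))%E.
  rewrite -[in LHS](setDUK UA) measureU//; first exact: measurableD.
  by apply/seteqP; split => x // [Ux [_]].
rewrite QAU adde0 measure_semi_additive_ord//.
apply/trivIsetP => l l' _ _ ll'; apply/seteqP; split => x // [[_ Dlx] [_ Dl'x]].
by rewrite (Ddisj _ _ _ Dlx Dl'x) eqxx in ll'.
Qed.

End partition.

(** * One step of processor sharing *)

Section lists.
Context {R : realType}.
Implicit Types (w a r : R) (vs : seq R).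

Lemma lt_bigminE w a vs :
  (a < \big[Num.min/w]_(v <- vs) v) = (a < w) && all (fun v => a < v) vs.
Proof.
elim: vs => [|v vs IH]; first by rewrite big_nil andbT.
by rewrite big_cons lt_min IH /= andbCA.
Qed.

Lemma bigmin_mem w r vs : r \in w :: vs -> r <= w -> all (fun v => r <= v) vs ->
  \big[Num.min/w]_(v <- vs) v = r.
Proof.
move=> rin rw rvs; apply/eqP; rewrite eq_le; apply/andP; split.
  rewrite leNgt lt_bigminE; apply/negP => /andP[rw' /allP rvs'].
  move: rin; rewrite in_cons => /predU1P[rE|/rvs']; rewrite ?ltxx//.
  by rewrite rE ltxx in rw'.
elim: vs rvs {rin} => [|v vs IH]; first by rewrite big_nil.
by move=> /= /andP[rv /IH rvs]; rewrite big_cons le_min rv.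
Qed.

(** Removing one customer renumbers the others by [bump], which is injective, so
    that the result is again an initial list up to a relabelling. *)
Lemma take_drop_mkseq (f : nat -> R) n l : (l < n)%N ->
  take l (mkseq f n) ++ drop l.+1 (mkseq f n) = mkseq (fun q => f (bump l q)) n.-1.
Proof.
case: n => // n; rewrite ltnS => ln.
apply: (@eq_from_nth _ 0).
  rewrite size_cat size_takel ?size_mkseq ?(leqW ln)// size_drop !size_mkseq.
  by rewrite subSS subnKC.
move=> q; rewrite size_cat size_takel ?size_mkseq ?(leqW ln)// size_drop size_mkseq.
rewrite subSS subnKC// => qn.
rewrite nth_cat size_takel ?size_mkseq ?(leqW ln)// nth_mkseq// /bump.
case: ltnP => ql; first by rewrite nth_take// nth_mkseq// (ltn_trans ql).
by rewrite nth_drop addSn subnKC// nth_mkseq// add1n.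
Qed.

Lemma filter_gt_mkseq (f : nat -> R) n l : (l < n)%N ->
  (forall q, (q < n)%N -> q != l -> f l < f q) ->
  [seq v <- mkseq f n | f l < v] = mkseq (fun q => f (bump l q)) n.-1.
Proof.
move=> ln fmin; rewrite -take_drop_mkseq//.
have sz : (l < size (mkseq f n))%N by rewrite size_mkseq.
rewrite -{1}(cat_take_drop l (mkseq f n)) (drop_nth 0)// nth_mkseq//.
rewrite filter_cat /= ltxx; congr (_ ++ _); apply/all_filterP/(all_nthP 0) => q.
  rewrite size_takel ?(ltnW sz)// => ql; rewrite nth_take// nth_mkseq ?(ltn_trans ql)//.
  by apply: fmin; rewrite ?(ltn_trans ql)// ltn_eqF.
rewrite size_drop size_mkseq ltn_subRL => ql.
by rewrite nth_drop nth_mkseq//; apply: fmin => //; rewrite gtn_eqF// addSn ltnS leq_addr.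
Qed.

End lists.

Section ps_steps.
Context {R : realType}.
Variables (b gap work mark : nat -> R).
Local Notation step := (ps_step b gap work mark).

Lemma ps_step_arrival (c w a : R) (f : nat -> R) n j : 0 < a ->
  a / n.+1%:R < w -> (forall q, (q < n)%N -> a / n.+1%:R < f q) ->
  step (PSState c w (mkseq f n) a j) =
  PSState (c + a) (w - a / n.+1%:R)
    (let others := mkseq (fun q => f q - a / n.+1%:R) n in
     if mark j < b n.+1 then rcons others (work j) else others) (gap j) j.+1.
Proof.
move=> a0 aw af; rewrite /ps_step /ps_done /= size_mkseq.
have n0 : 0 < n.+1%:R :> R by rewrite ltr0n.
have w0 : 0 < w by rewrite (lt_trans _ aw)// divr_gt0.
rewrite leNgt w0 /= leNgt -ltr_pdivrMl// mulrC lt_bigminE aw /=.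
have -> /= : all (fun v => a / n.+1%:R < v) (mkseq f n).
  by apply/(all_nthP 0) => q; rewrite size_mkseq => qn; rewrite nth_mkseq// af.
by rewrite [X in if _ then rcons X _ else _](_ : _ = mkseq (fun q => f q - a / n.+1%:R) n)
  // /mkseq -map_comp.
Qed.

Lemma ps_step_tagged (c w a : R) (f : nat -> R) n j : 0 < w ->
  (forall q, (q < n)%N -> w < f q) -> n.+1%:R * w <= a ->
  exists x, [/\ step (PSState c w (mkseq f n) a j) = x, ps_done x &
                ps_clock x = c + n.+1%:R * w].
Proof.
move=> w0 wf wa.
exists (PSState (c + n.+1%:R * w) (w - w) [seq v - w | v <- mkseq f n & w < v]
  (a - n.+1%:R * w) j); split => //; last by rewrite /ps_done /= subrr.
rewrite /ps_step /ps_done /= size_mkseq leNgt w0 /= (@bigmin_mem _ w w) ?wa//.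
- by rewrite mem_head.
- by apply/(all_nthP 0) => q; rewrite size_mkseq => qn; rewrite nth_mkseq// ltW// wf.
Qed.

Lemma ps_step_other (c w a : R) (f : nat -> R) n l j : (l < n)%N -> 0 < f l ->
  f l < w -> (forall q, (q < n)%N -> q != l -> f l < f q) -> n.+1%:R * f l <= a ->
  step (PSState c w (mkseq f n) a j) =
  PSState (c + n.+1%:R * f l) (w - f l)
    (mkseq (fun q => f (bump l q) - f l) n.-1) (a - n.+1%:R * f l) j.
Proof.
move=> ln fl0 flw flmin fla.
rewrite /ps_step /ps_done /= size_mkseq leNgt (lt_trans fl0 flw) /=.
rewrite (bigmin_mem _ (ltW flw)); last 2 first.
- by rewrite in_cons; apply/orP; right; apply/mapP; exists l; rewrite ?mem_iota.
- apply/(all_nthP 0) => q; rewrite size_mkseq => qn; rewrite nth_mkseq//.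
  by have [->|/(flmin q qn)/ltW] := eqVneq q l.
by rewrite fla filter_gt_mkseq// /mkseq -map_comp.
Qed.

End ps_steps.

(** * The law of the processor sharing path *)

Section ps.
Context {R : realType}.
Notation L := (measurableTypeR R).
Variables (rho : R) (rho_gt0 : 0 < rho) (b : nat -> R) (t : R).
Notation S := (@streams R source).
Implicit Types (z : S) (x : ps_state (R := R)).

Definition ps_run z m x : ps_state :=
  iter m (ps_step b (fun j => z (Gap j)) (fun j => z (Work j)) (fun j => z (Mark j))) x.

Definition ps_left z m x : bool :=
  ps_done (ps_run z m x) && (ps_clock (ps_run z m x) <= t).

Definition ps_start n j (c : R) z : ps_state :=
  PSState c (z (Work 0)) (mkseq (fun i => z (Residual i)) n) (z (Gap 0)) j.

Lemma ps_leftS z m x :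
  ps_left z m.+1 x = ps_left z m (ps_step b (fun j => z (Gap j))
    (fun j => z (Work j)) (fun j => z (Mark j)) x).
Proof. by rewrite /ps_left /ps_run iterSr. Qed.

Lemma ps_left_done z m x : ps_done x -> ps_left z m x = (ps_clock x <= t).
Proof.
move=> xd; rewrite /ps_left (_ : ps_run z m x = x) ?xd//.
by elim: m => //= m IH; rewrite /ps_run /= -/(ps_run z m x) IH /ps_step xd.
Qed.

(** The future of a state involves only the arrivals that are still to come;
    this is what allows the coordinates already consumed to be renamed. *)
Lemma ps_left_local z z' m x :
  (forall i, (ps_arrival x <= i)%N -> [/\ z (Gap i) = z' (Gap i),
     z (Work i) = z' (Work i) & z (Mark i) = z' (Mark i)]) ->
  ps_left z m x = ps_left z' m x.
Proof.
move=> zz'; rewrite /ps_left (_ : ps_run z m x = ps_run z' m x)//.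
elim: m x zz' => // m IH x zz'; rewrite /ps_run !iterSr.
have -> : ps_step b (fun j => z (Gap j)) (fun j => z (Work j))
    (fun j => z (Mark j)) x = ps_step b (fun j => z' (Gap j))
    (fun j => z' (Work j)) (fun j => z' (Mark j)) x.
  by rewrite /ps_step; have [-> -> ->] := zz' _ (leqnn _).
apply: IH => i xi; apply: zz'; apply: leq_trans xi.
by rewrite /ps_step; case: ifP => // _; case: ifP.
Qed.

Lemma measurable_ps_left d (D : measurableType d) (z : D -> S) m
    (x : D -> ps_state) : measurable_fun setT z -> ps_measurable x ->
  measurable [set w | ps_left (z w) m (x w)].
Proof.
move=> mz mx.
have mcoord (i : source) : measurable_fun setT (fun w => z w i : L).
  exact: (measurableT_comp (@measurable_coord R _ i) mz).
have [mc mt _ _ _] := @ps_measurable_iter R _ D b (fun w j => z w (Gap j))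
  (fun w j => z w (Work j)) (fun w j => z w (Mark j)) (fun j => mcoord _)
  (fun j => mcoord _) (fun j => mcoord _) m _ mx.
suff : measurable_fun setT (fun w => ps_left (z w) m (x w)).
  by move=> /(_ measurableT [set true]); rewrite setTI; apply.
by apply: measurable_and; exact: measurable_fun_ler.
Qed.

Lemma ps_measurable_start d (D : measurableType d) (z : D -> S) n j (c : D -> L) :
  measurable_fun setT z -> measurable_fun setT c ->
  ps_measurable (fun w => ps_start n j (c w) (z w)).
Proof.
move=> mz mc.
have mcoord (i : source) : measurable_fun setT (fun w => z w i : L).
  exact: (measurableT_comp (@measurable_coord R _ i) mz).
split => //=.
by apply: (@measurable_seq_mkseq R _ D n (fun i w => z w (Residual i))).
Qed.

Lemma measurable_ps_start m n j (c : R) :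
  measurable [set z | ps_left z m (ps_start n j c z)].
Proof.
apply: measurable_ps_left; first exact: measurable_id.
exact: (@ps_measurable_start _ S id n j (fun=> c)).
Qed.

(** The tagged customer is number 0, as in [after_service]. *)
Definition customer i : source := if i is i'.+1 then Residual i' else Work 0.

Lemma customer_inj : injective customer.
Proof. by move=> [|i] [|j] // [->]. Qed.

Definition customers n : seq source := mkseq customer n.+1.

Lemma customers_uniq n : uniq (customers n).
Proof. by rewrite map_inj_uniq ?iota_uniq//; exact: customer_inj. Qed.

Section law.
Hypothesis b01 : forall n, 0 <= b n <= 1.
Variables (found_law : probability L R) (Q : probability S R).
Hypothesis QP : product_law Q (queue_law rho_gt0 found_law).

(** Each customer receives service at rate 1 / (n + 1), hence the amount
    Gap 0 / (n + 1) before the next arrival. *)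
Definition arrival_first n : set S :=
  [set z | forall i, i \in customers n -> z (Gap 0) / n.+1%:R < z i].

Definition others n l := [seq i <- customers n | i != customer l].

Lemma size_others n l : (l < n.+1)%N -> size (others n l) = n.
Proof.
move=> ln; have lin : customer l \in customers n.
  by apply/mapP; exists l; rewrite ?mem_iota.
rewrite /others -rem_filter ?customers_uniq//.
by rewrite size_rem// size_mkseq.
Qed.

Definition service_first n l : set S :=
  [set z | (forall i, i \in others n l -> z (customer l) < z i) /\
           n.+1%:R * z (customer l) <= z (Gap 0)].

(** The race won by the customer l.  Conditioning on its requirement u by
    [resample_pos], the n others must exceed u and the next arrival must come
    after (n + 1) u; by memorylessness these events have probabilities
    exp(- n u) and exp(- rho (n + 1) u), and what remains is distributed as a
    fresh family, on which the event B u is evaluated. *)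
Lemma service_event n l (A : set S) (B : R -> set S) : (l < n.+1)%N ->
  measurable A -> measurable (service_first n l) -> (forall u, measurable (B u)) ->
  (forall u z, 0 < u -> (forall i, i \in others n l -> u < z i) ->
     n.+1%:R * u <= z (Gap 0) ->
     A (upd z (customer l) u) <->
     B u (upd (shift_on (others n l) u z) (Gap 0) (z (Gap 0) - n.+1%:R * u))) ->
  Q (A `&` service_first n l) =
  (\int[exp_law (@ltr01 R)]_(u in `]0%R, +oo[)
     ((expR (- n%:R * u))%:E *
      ((expR (- rho * (n.+1%:R * u)))%:E * Q (B u))))%E.
Proof.
move=> ln mA mS mB AB.
have lawl : queue_law rho_gt0 found_law (customer l) = exp_law (@ltr01 R).
  by case: (l).
rewrite (resample_pos QP lawl); last exact: measurableI.
apply: eq_integral => u; rewrite inE/= in_itv/= andbT => u0.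
have ku0 : 0 <= n.+1%:R * u by rewrite mulr_ge0// ltW.
have gNothers : Gap 0 \in others n l = false.
  rewrite mem_filter; apply/negP => /andP[_ /mapP[q _]]; by case: q.
pose A1 : set S := [set z | z (Gap 0) \in Interval (BSide true (n.+1%:R * u)) +oo%O /\
  B u (upd z (Gap 0) (z (Gap 0) - n.+1%:R * u))].
have mA1 : measurable A1 by exact: measurable_memoryless_coord.
have QA1 : Q A1 = ((expR (- rho * (n.+1%:R * u)))%:E * Q (B u))%E.
  by apply: (memoryless_coord QP (rate_gt0 := rho_gt0)).
have uniq_others : uniq (others n l) by rewrite filter_uniq// customers_uniq.
have law_others i : i \in others n l ->
    queue_law rho_gt0 found_law i = exp_law (@ltr01 R).
  by rewrite mem_filter => /andP[_ /mapP[q _ ->]]; case: q.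
have gE z : shift_on (others n l) u z (Gap 0) = z (Gap 0).
  by rewrite /shift_on gNothers.
have := memoryless_coords QP uniq_others law_others (ltW u0) mA1.
rewrite (size_others ln) QA1 => <-.
congr (Q _); apply/seteqP; split => z /=.
- move=> [Az [oz gz]].
  have oz' i : i \in others n l -> u < z i.
    move=> io; have := oz i io; rewrite upd_eq upd_neq//.
    by move: io; rewrite mem_filter => /andP[].
  have gz' : n.+1%:R * u <= z (Gap 0).
    by move: gz; rewrite upd_eq upd_neq//; case: (l).
  split=> //; rewrite /A1 /= in_itv/= andbT gE; split => //.
  exact/AB.
- move=> [oz]; rewrite /A1 /= in_itv/= andbT gE => -[gz Bz].
  split; first exact/AB.
  split=> [i io|]; last by rewrite upd_eq upd_neq//; case: (l).
  rewrite upd_eq upd_neq ?oz//.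
  by move: io; rewrite mem_filter => /andP[].
Qed.

Lemma measurable_all_lt (J : seq source) (f : S -> L) (g : source -> S -> L) :
  measurable_fun setT f -> (forall i, measurable_fun setT (g i)) ->
  measurable [set z | forall i, i \in J -> f z < g i z].
Proof.
move=> mf mg.
suff mb : measurable_fun setT (fun z => all (fun i => f z < g i z) J).
  rewrite (_ : mkset _ = (fun z => all (fun i => f z < g i z) J) @^-1` [set true]).
    by rewrite -[X in measurable X]setTI; exact: mb.
  by apply/seteqP; split => z /= => [zJ|/allP//]; apply/allP.
elim: J => [|i J IH] //=.
by apply: measurable_and => //; exact: (measurable_fun_ltr mf (mg i)).
Qed.

Lemma measurable_service_first n l : measurable (service_first n l).
Proof.
have mcoord := @measurable_coord R source.
apply: measurableI; first exact: measurable_all_lt.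
suff mb : measurable_fun setT (fun z : S => n.+1%:R * z (customer l) <= z (Gap 0)).
  by rewrite -[X in measurable X]setTI; apply: (mb _ [set true]).
apply: measurable_fun_ler; last exact: mcoord.
by apply: measurable_funM => //; exact: mcoord.
Qed.

Lemma measurable_arrival_first n : measurable (arrival_first n).
Proof.
have mcoord := @measurable_coord R source.
by apply: measurable_all_lt => //; apply: measurable_funM => //; exact: mcoord.
Qed.

Definition ties : set S :=
  \bigcup_p \bigcup_q [set z | p != q /\ z (customer p) = z (customer q)].

Lemma ties_negligible : Q.-negligible ties.
Proof.
apply: negligible_bigcup => p; apply: negligible_bigcup => q.
have [->|pq] := eqVneq p q.
  by apply: negligibleS (negligible_set0 Q) => z [].
pose E : set S := [set z | z (customer p) = z (customer q)].
suff : Q.-negligible E by apply: negligibleS => z [].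
apply/negligibleP; last first.
  apply: (no_tie QP (rate_gt0 := @ltr01 R)); first by case: (p).
  by apply: contra_neq pq; exact: customer_inj.
have mcoord := @measurable_coord R source.
suff mb : measurable_fun setT (fun z : S => z (customer p) == z (customer q)).
  rewrite (_ : E = (fun z : S => z (customer p) == z (customer q)) @^-1` [set true]).
    by rewrite -[X in measurable X]setTI; apply: (mb _ [set true]).
  by apply/seteqP; split => z /= /eqP.
by apply: measurable_fun_eqr; exact: mcoord.
Qed.

Lemma service_first_disjoint n l l' z : (l < n.+1)%N -> (l' < n.+1)%N ->
  service_first n l z -> service_first n l' z -> l = l'.
Proof.
move=> ln l'n [zl _] [zl' _]; apply/eqP; apply/negPn/negP => ll'.
have mem q : (q < n.+1)%N -> customer q \in customers n.
  by move=> qn; apply/mapP; exists q; rewrite ?mem_iota.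
have l'o : customer l' \in others n l.
  by rewrite mem_filter mem// andbT; apply: contra_neq ll' => /customer_inj.
have lo : customer l \in others n l'.
  by rewrite mem_filter mem// andbT; apply: contra_neq ll' => /customer_inj.
by have := lt_trans (zl _ l'o) (zl' _ lo); rewrite ltxx.
Qed.

Lemma service_first_arrival n l : (l < n.+1)%N ->
  service_first n l `<=` ~` arrival_first n.
Proof.
move=> ln z [_ kl] /(_ (customer l)).
rewrite ltr_pdivrMr ?ltr0n// mulrC ltNge kl => /(_ _)/negP; apply => //.
by apply/mapP; exists l; rewrite ?mem_iota.
Qed.

Lemma service_first_cover n z : ~ arrival_first n z ->
  ties z \/ exists l : 'I_n.+1, service_first n l z.
Proof.
move=> narr.
have [l _ lmin] := @arg_minP _ _ 'I_n.+1 ord0 xpredT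
  (fun l => z (customer l)) isT.
have {}lmin (q : 'I_n.+1) : z (customer l) <= z (customer q) by exact: lmin.
have kl : n.+1%:R * z (customer l) <= z (Gap 0).
  rewrite leNgt; apply/negP => kl; apply: narr => i /mapP[q].
  rewrite mem_iota /= => qn ->; rewrite ltr_pdivrMr ?ltr0n// mulrC.
  apply: lt_le_trans kl _; rewrite ler_pM2l ?ltr0n//.
  exact: (lmin (Ordinal qn)).
have [lt_others|] := pselect (forall i, i \in others n l -> z (customer l) < z i).
  by right; exists l.
move=> /existsNP[i /not_implyP[]]; rewrite mem_filter => /andP[il /mapP[q]].
rewrite mem_iota /= => qn iq /negP; rewrite -leNgt => zil.
left; exists (nat_of_ord l) => //; exists q => //; split.
  by apply/eqP => lq; move: il; rewrite iq lq eqxx.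
apply/eqP; rewrite eq_le -iq zil andbT iq; exact: (lmin (Ordinal qn)).
Qed.

Lemma shift_on_others n l u z i : (forall q, i <> customer q) ->
  shift_on (others n l) u z i = z i.
Proof.
move=> iq; rewrite /shift_on mem_filter; case: andP => // -[_ /mapP[q _ iE]].
by case: (iq q).
Qed.

Lemma mem_others n l q : (q < n.+1)%N -> q != l -> customer q \in others n l.
Proof.
move=> qn ql; rewrite mem_filter; apply/andP; split.
  by apply: contra_neq ql => /customer_inj.
by apply/mapP; exists q; rewrite ?mem_iota.
Qed.

Section step.
Variable m : nat.
Hypothesis IH : forall n j c, (0 < j)%N ->
  Q [set z | ps_left z m (ps_start n j c z)] = served_within rho_gt0 b t m n c.

(** If l = 0 the tagged customer leaves at the time of the completion;
    otherwise the state is, up to the renumbering of the others, an initial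
    state with n - 1 others, to which the induction hypothesis applies. *)
Lemma ps_service_term n l j c : (l < n.+1)%N -> (0 < j)%N ->
  Q ([set z | ps_left z m.+1 (ps_start n j c z)] `&` service_first n l) =
  ((n.+1%:R^-1)%:E * \int[exp_law (@ltr01 R)]_(s in `]0%R, +oo[)
     ((expR (- rho * s))%:E *
      after_service t (served_within rho_gt0 b t m) n l (c + s)))%E.
Proof.
move=> ln j0.
have mid : measurable_fun setT (@id S) by exact: measurable_id.
pose st l' u z := PSState (c + n.+1%:R * u) (z (Work 0))
  (mkseq (fun q => z (Residual (bump l' q))) n.-1) (z (Gap 0)) j.
pose B l0 u : set S := if l0 is l'.+1 then [set z | ps_left z m (st l' u z)]
  else if c + n.+1%:R * u <= t then setT else set0.
have mcoord (i : source) : measurable_fun setT (fun z : S => z i : L).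
  exact: measurable_coord.
have mB u : measurable (B l u).
  rewrite /B; case: (l) => [|l']; first by case: ifP.
  apply: measurable_ps_left => //; split => //=.
  by apply: (@measurable_seq_mkseq R _ S n.-1 (fun i z => z (Residual (bump l' i)))).
have QB u : Q (B l u) =
    after_service t (served_within rho_gt0 b t m) n l (c + n.+1%:R * u).
  rewrite /B /after_service; case: (l) => [|l'].
    by case: ifP; rewrite ?probability_setT ?measure0.
  rewrite -(IH _ _ j0).
  (* the others are numbered with a gap at l', which [bump] removes *)
  pose s (i : source) := if i is Residual q then Residual (bump l' q) else i.
  rewrite -[RHS](product_law_relabel QP (s := s)).
  - congr (Q _); apply/seteqP; split => z /=;
      by rewrite (@ps_left_local (relabel s z) z).
  - by move=> [|p|p|p|p] [|q|q|q|q] //= [/(can_inj (bumpK _)) ->].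
  - by case.
  - exact: measurable_ps_start.
rewrite (service_event (B := B l))//; last 3 first.
- exact: measurable_ps_start.
- exact: measurable_service_first.
- move=> u z u0 uo kuz; rewrite /= ps_leftS.
  have uq q : (q < n.+1)%N -> q != l -> u < z (customer q).
    by move=> qn ql; apply: uo; exact: mem_others.
  rewrite /B; case: l ln uo uq {mB QB} => [|l'] ln uo uq.
    have [x [-> xd xc]] := @ps_step_tagged R b (fun i => upd z (Work 0) u (Gap i))
      (fun i => upd z (Work 0) u (Work i)) (fun i => upd z (Work 0) u (Mark i))
      c u (z (Gap 0)) (fun i => z (Residual i)) n j u0 (fun q qn => uq q.+1 qn isT) kuz.
    by rewrite ps_left_done// xc; case: ifP.
  set z1 := upd z _ u; set y := upd _ _ _.
  pose f q := z1 (Residual q).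
  have fl : f l' = u by rewrite /f /z1 upd_eq.
  have fq q : q != l' -> f q = z (Residual q).
    by move=> ql; rewrite /f /z1 upd_neq//; apply: contra_neq ql => -[].
  rewrite -/f (@ps_step_other _ _ _ _ _ _ _ _ f n l') ?fl//; last 2 first.
  + exact: (uq 0%N).
  + by move=> q qn ql; rewrite fq// (uq q.+1).
  rewrite (@ps_left_local z1 y m) => [|i ji].
    have yW : z1 (Work 0) - u = y (Work 0).
      by rewrite /y /z1 !upd_neq// /shift_on (mem_others (q := 0)).
    have yG : z1 (Gap 0) - n.+1%:R * u = y (Gap 0) by rewrite /y upd_eq /z1 upd_neq.
    rewrite yW yG (_ : mkseq _ _ = mkseq (fun q => y (Residual (bump l' q))) n.-1)//.
    apply/eq_in_map => q; rewrite mem_iota /= add0n => qn.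
    have bl : bump l' q != l' by rewrite eq_sym neq_bump.
    rewrite fq// /y upd_neq// /shift_on ifT//.
    rewrite (mem_others (q := (bump l' q).+1))// ltnS /bump.
    move: qn; rewrite ltn_predRL => qn.
    by case: (l' <= q)%N; [exact: qn|exact: ltnW qn].
  have i0 : i != 0%N by rewrite -lt0n (leq_trans j0).
  rewrite /y /z1; split; rewrite !upd_neq//.
  + by rewrite shift_on_others// => -[].
  + by rewrite shift_on_others// => -[|q] // [i00]; rewrite i00 in i0.
  + by rewrite shift_on_others// => -[].
pose h (s : L) := ((expR (- rho * s))%:E *
  after_service t (served_within rho_gt0 b t m) n l (c + s))%E.
have mh : measurable_fun setT h.
  apply: emeasurable_funM.
    by apply/measurable_EFinP; apply: measurableT_comp => //; exact: mulrl_measurable.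
  rewrite /after_service; case: (l) => [|l'].
    apply: measurable_fun_ifT => //; apply: measurable_fun_ler => //.
    exact: measurable_funD.
  pose C : set (L * S) := [set sz | ps_left sz.2 m (ps_start n.-1 j (c + sz.1) sz.2)].
  rewrite (_ : (fun _ => _) = Q \o xsection C).
    apply: measurable_fun_xsection; apply: measurable_ps_left => //.
    by apply: ps_measurable_start => //; exact: measurable_funD.
  apply/funext => s /=; rewrite -(IH _ _ j0); congr (Q _).
  by apply/seteqP; split => z; rewrite /xsection/= inE.
have h0 s : (0 <= h s)%E.
  rewrite /h mule_ge0// ?lee_fin ?expR_ge0// /after_service.
  by case: (l) => [|l']; [case: ifP|exact: served_within_ge0].
transitivity (\int[exp_law (@ltr01 R)]_(u in `]0%R, +oo[)
    ((expR (- n%:R * u))%:E * h (n.+1%:R * u)%R))%E.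
  by apply: eq_integral => u _; rewrite QB.
exact: integral_exp_law_scale.
Qed.

(** Exchanging the requirement of arrival j with the one of the unused index n
    among the residuals, and the next gap with the first one, turns the state
    after an accepted arrival into an initial state with n + 1 others. *)
Lemma ps_admitted n j c : (0 < j)%N ->
  Q [set z | ps_left z m (PSState c (z (Work 0))
      (rcons (mkseq (fun i => z (Residual i)) n) (z (Work j))) (z (Gap j)) j.+1)] =
  served_within rho_gt0 b t m n.+1 c.
Proof.
move=> j0; rewrite -(IH _ _ (ltn0Sn j)).
pose s (i : source) := match i with
  | Residual q => if q == n then Work j else i
  | Work q => if q == j then Residual n else i
  | Gap q => if q == 0%N then Gap j else if q == j then Gap 0 else i
  | _ => i
  end.
have sK : involutive s.
  move=> [|q|q|q|q] //=.
  - by case: eqP => [->|/eqP/negbTE qn] /=; rewrite ?eqxx ?qn.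
  - case: (eqVneq q 0%N) => [->|q0] /=; first by rewrite eqxx gtn_eqF.
    by case: eqP => [->|/eqP/negbTE qj] /=; rewrite ?eqxx// (negbTE q0) qj.
  - by case: eqP => [->|/eqP/negbTE qj] /=; rewrite ?eqxx ?qj.
rewrite -[RHS](product_law_relabel QP (s := s)).
- congr (Q _); apply/seteqP.
  suff zs z : ps_left z m (PSState c (z (Work 0))
      (rcons (mkseq (fun i => z (Residual i)) n) (z (Work j))) (z (Gap j)) j.+1) =
      ps_left (relabel s z) m (ps_start n.+1 j.+1 c (relabel s z)).
    by split => z /=; rewrite zs.
  rewrite (@ps_left_local z (relabel s z)).
    congr (ps_left _ _ (PSState _ _ _ _ _)); rewrite /relabel /=.
    + by rewrite ltn_eqF.
    + rewrite mkseqS eqxx; congr rcons; apply/eq_in_map => q.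
      by rewrite mem_iota /= add0n => qn; rewrite ltn_eqF.
  move=> i /= ji; rewrite /relabel /=.
  by rewrite (gtn_eqF ji) (gtn_eqF (ltn_trans j0 ji)).
- exact: inv_inj.
- by case => //= q; case: ifP => //; case: ifP.
- exact: measurable_ps_start.
Qed.

Lemma ps_balked n j c : (0 < j)%N ->
  Q [set z | ps_left z m (PSState c (z (Work 0))
      (mkseq (fun i => z (Residual i)) n) (z (Gap j)) j.+1)] =
  served_within rho_gt0 b t m n c.
Proof.
move=> j0; rewrite -(IH _ _ (ltn0Sn j)).
pose s (i : source) := if i is Gap q then
  if q == 0%N then Gap j else if q == j then Gap 0 else i else i.
have sK : involutive s.
  move=> [|q|q|q|q] //=.
  case: (eqVneq q 0%N) => [->|q0] /=; first by rewrite eqxx gtn_eqF.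
  by case: eqP => [->|/eqP/negbTE qj] /=; rewrite ?eqxx// (negbTE q0) qj.
rewrite -[RHS](product_law_relabel QP (s := s)).
- congr (Q _); apply/seteqP.
  suff zs z : ps_left z m (PSState c (z (Work 0))
      (mkseq (fun i => z (Residual i)) n) (z (Gap j)) j.+1) =
      ps_left (relabel s z) m (ps_start n j.+1 c (relabel s z)).
    by split => z /=; rewrite zs.
  rewrite (@ps_left_local z (relabel s z))// => i /= ji; rewrite /relabel /=.
  by rewrite (gtn_eqF ji) (gtn_eqF (ltn_trans j0 ji)).
- exact: inv_inj.
- by case => //= q; case: ifP => //; case: ifP.
- exact: measurable_ps_start.
Qed.

(** The arrival comes at a if the n + 1 requirements all exceed a / (n + 1),
    which has probability exp(- a); their excesses are fresh requirements by
    [memoryless_coords], and the mark of the arrival is independent of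
    everything that follows. *)
Lemma ps_arrival_term n j c : (0 < j)%N ->
  Q ([set z | ps_left z m.+1 (ps_start n j c z)] `&` arrival_first n) =
  (\int[exp_law rho_gt0]_(a in `]0%R, +oo[)
     ((expR (- a))%:E * ((b n.+1)%:E * served_within rho_gt0 b t m n.+1 (c + a) +
        (1 - b n.+1)%:E * served_within rho_gt0 b t m n (c + a))))%E.
Proof.
move=> j0.
have mid : measurable_fun setT (@id S) by exact: measurable_id.
have mcoord (i : source) : measurable_fun setT (fun z : S => z i : L).
  exact: measurable_coord.
have mA : measurable [set z | ps_left z m.+1 (ps_start n j c z)].
  exact: measurable_ps_start.
rewrite (resample_pos QP (rate_gt0 := rho_gt0) (i := Gap 0))//; last first.
  by apply: measurableI => //; exact: measurable_arrival_first.
apply: eq_integral => a; rewrite inE/= in_itv/= andbT => a0.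
have mres : measurable_seq (fun z : S => mkseq (fun i => z (Residual i)) n).
  by apply: (@measurable_seq_mkseq R _ S n (fun i z => z (Residual i))).
pose joined z := PSState (c + a) (z (Work 0))
      (rcons (mkseq (fun i => z (Residual i)) n) (z (Work j))) (z (Gap j)) j.+1.
pose balked z := PSState (c + a) (z (Work 0))
      (mkseq (fun i => z (Residual i)) n) (z (Gap j)) j.+1.
pose A1 : set S := [set z | ps_left z m (joined z)].
pose A2 : set S := [set z | ps_left z m (balked z)].
have mA1 : measurable A1.
  by apply: measurable_ps_left => //; split => //=; exact: measurable_seq_rcons.
have mA2 : measurable A2 by apply: measurable_ps_left => //; split => //=.
pose M1 : set S := [set z | `]-oo, b n.+1[%classic (z (Mark j))].
pose M2 : set S := [set z | (~` `]-oo, b n.+1[%classic) (z (Mark j))].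
have mB : measurable (`]-oo, b n.+1[%classic : set L) by exact: measurable_itv.
have mM1 : measurable M1.
  by rewrite -[X in measurable X]setTI; exact: (mcoord (Mark j)).
have mM2 : measurable M2.
  rewrite -[X in measurable X]setTI; apply: (mcoord (Mark j)) => //.
  exact: measurableC.
pose A' : set S := (M1 `&` A1) `|` (M2 `&` A2).
have mA' : measurable A' by apply: measurableU; exact: measurableI.
transitivity (Q [set z | (forall i, i \in customers n -> a / n.+1%:R < z i) /\
                         A' (shift_on (customers n) (a / n.+1%:R) z)]).
  congr (Q _); apply/seteqP.
  suff Az z : (forall i, i \in customers n -> a / n.+1%:R < z i) ->
      ps_left (upd z (Gap 0) a) m.+1 (ps_start n j c (upd z (Gap 0) a)) <->
      A' (shift_on (customers n) (a / n.+1%:R) z).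
    split => z /=.
      move=> [Az' arr].
      have arr' i : i \in customers n -> a / n.+1%:R < z i.
        move=> ic; have := arr i ic; rewrite upd_eq upd_neq//.
        by apply/eqP => iE; move: ic; rewrite iE => /mapP[[|q]].
      by split => //; apply/Az.
    move=> [arr Az']; split; first exact/Az.
    move=> i ic; rewrite upd_eq upd_neq ?arr//.
    by apply/eqP => iE; move: ic; rewrite iE => /mapP[[|q]].
  move=> arr.
  have {}arr q : (q < n.+1)%N -> a / n.+1%:R < z (customer q).
    by move=> qn; apply: arr; apply/mapP; exists q; rewrite ?mem_iota.
  rewrite ps_leftS ps_step_arrival//; last 2 first.
  + exact: (arr 0%N).
  + by move=> q qn; exact: (arr q.+1).
  set y := shift_on _ _ _.
  have yN i : (forall q, i <> customer q) -> y i = z i.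
    by move=> iq; rewrite /y /shift_on; case: mapP => // -[q _ /iq].
  have yC q : (q < n.+1)%N -> y (customer q) = z (customer q) - a / n.+1%:R.
    move=> qn; rewrite /y /shift_on ifT//.
    by apply/mapP; exists q; rewrite ?mem_iota.
  have loc st : ps_arrival st = j.+1 -> ps_left (upd z (Gap 0) a) m st = ps_left y m st.
    move=> stj; apply: ps_left_local => i; rewrite stj => ji.
    rewrite !yN; [|by case|case=> //|by case].
      split; rewrite upd_neq//; apply/eqP => -[i0]; by rewrite i0 in ji.
    by move=> [i0]; rewrite i0 in ji.
  have yW : y (Work j) = z (Work j).
    by rewrite yN// => -[] // [j00]; rewrite j00 in j0.
  have yM : y (Mark j) = z (Mark j) by rewrite yN// => -[].
  have yG : y (Gap j) = z (Gap j) by rewrite yN// => -[].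
  have yR : mkseq (fun q => upd z (Gap 0) a (Residual q) - a / n.+1%:R) n =
      mkseq (fun q => y (Residual q)) n.
    by apply/eq_in_map => q; rewrite mem_iota /= add0n => qn; rewrite (yC q.+1)// upd_neq.
  rewrite loc// upd_eq !upd_neq//; last by apply/eqP => -[j00]; rewrite j00 in j0.
  rewrite yR.
  rewrite [X in _ <-> X](_ : _ = ((y (Mark j) < b n.+1) /\ A1 y \/
      ~ (y (Mark j) < b n.+1) /\ A2 y)); last first.
    by rewrite /A' /M1 /M2 /setU /setI /= in_itv.
  rewrite /A1 /A2 /joined /balked /= yM yW yG (yC 0%N)//.
  by case: ifP => zb; intuition.
rewrite (memoryless_coords QP (customers_uniq n))//; last 2 first.
- by move=> i /mapP[[|q] _ ->].
- by rewrite divr_ge0// ltW.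
rewrite size_mkseq; congr ((expR _)%:E * _)%E.
  by rewrite mulNr mulrCA divff ?mulr1 ?gt_eqF.
have mark_law : (uniform_prob (@ltr01 R) `]-oo, b n.+1[%classic = (b n.+1)%:E)%E.
  exact: uniform_prob_ray.
have Q1 : Q (M1 `&` A1) = ((b n.+1)%:E * served_within rho_gt0 b t m n.+1 (c + a))%E.
  rewrite -(ps_admitted _ _ j0) -mark_law.
  apply: (independent_coord QP mB mA1) => z x; rewrite /A1 /joined /= !upd_neq//.
  rewrite (@ps_left_local _ z)// => i ji; split; rewrite upd_neq//.
  by apply/eqP => -[ij]; rewrite ij /= ltnn in ji.
have Q2 : Q (M2 `&` A2) = ((1 - b n.+1)%:E * served_within rho_gt0 b t m n (c + a))%E.
  rewrite -(ps_balked _ _ j0) EFinB -mark_law.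
  transitivity (queue_law rho_gt0 found_law (Mark j)
    (~` `]-oo, b n.+1[%classic) * Q A2)%E.
    apply: (independent_coord QP (measurableC mB) mA2) => z x.
    rewrite /A2 /balked /= !upd_neq//.
    rewrite (@ps_left_local _ z)// => i ji; split; rewrite upd_neq//.
    by apply/eqP => -[ij]; rewrite ij /= ltnn in ji.
  by rewrite probability_setC.
rewrite -Q1 -Q2; apply: measureU; [exact: measurableI|exact: measurableI|].
by apply/seteqP; split => z // [[? _] [? _]].
Qed.

End step.

(** The induction on m starts from an event that is only negligible: without
    any step the tagged customer has left exactly when its requirement is not
    positive. *)
Lemma ps_left_law m n j c : (0 < j)%N ->
  Q [set z | ps_left z m (ps_start n j c z)] = served_within rho_gt0 b t m n c.
Proof.
elim: m n j c => [|m IH] n j c j0.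
  rewrite (resample_pos QP (rate_gt0 := @ltr01 R) (i := Work 0))//; last first.
    exact: measurable_ps_start.
  rewrite integral0_eq// => w; rewrite /= in_itv/= andbT => w0.
  rewrite (_ : mkset _ = set0) ?measure0//; apply/seteqP; split => z //=.
  by rewrite /ps_left /ps_run /= /ps_done /= upd_eq leNgt w0.
set A := [set z | ps_left z m.+1 (ps_start n j c z)].
have mA : measurable A by exact: measurable_ps_start.
have marr := measurable_arrival_first n.
rewrite (measureDI Q mA marr) /=; congr (_ + _)%E; last exact: ps_arrival_term.
rewrite (measure_partition (D := fun l : 'I_n.+1 => service_first n l)
  (N := ties)).
- apply: eq_bigr => l _; rewrite -(ps_service_term IH _ (ltn_ord l) j0).
  congr (Q _); apply/seteqP; split => z [Az sz]; split => //; first by case: Az.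
  by split => //; exact: service_first_arrival sz.
- exact: measurableD.
- by move=> l; exact: measurable_service_first.
- exact: ties_negligible.
- by move=> l l' z lz l'z; apply/val_inj; exact: service_first_disjoint lz l'z.
- by move=> z [_] /service_first_cover.
Qed.

End law.
End ps.

(** * The law of the random order of service path *)

Section uniform_pick.
Context {R : realType}.
Notation L := (measurableTypeR R).

Lemma uniform_prob_truncn n l : (l < n.+1)%N ->
  uniform_prob (@ltr01 R) [set v | Num.truncn (v * n.+1%:R) = l] = (n.+1%:R^-1)%:E.
Proof.
move=> ln; have n0 : 0 < n.+1%:R :> R by rewrite ltr0n.
have n1 : n.+1%:R != 0 :> R by rewrite gt_eqF.
have ray (q : nat) : (q <= n.+1)%N ->
    uniform_prob (@ltr01 R) `]-oo, q%:R / n.+1%:R[%classic = (q%:R / n.+1%:R)%:E.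
  move=> qn; apply: uniform_prob_ray.
  by rewrite divr_ge0//= ler_pdivrMr// mul1r ler_nat.
rewrite (_ : mkset _ = `]-oo, l.+1%:R / n.+1%:R[%classic `\`
    (if l == 0%N then set0 else `]-oo, l%:R / n.+1%:R[%classic)); last first.
  apply/seteqP; split => v /=.
    move/eqP; rewrite truncn_eqE -ltNge => /andP[lv vl].
    split; first by rewrite in_itv/= ltr_pdivlMr.
    case: eqP lv => [_ _ //|_ /= lv vl'].
    by move: vl'; rewrite in_itv/= ltr_pdivlMr// ltNge lv.
  rewrite in_itv/= ltr_pdivlMr// => -[vl lv]; apply/eqP.
  rewrite truncn_eqE -ltNge vl andbT; apply/orP.
  case: eqP lv => [_ _|_]; first by left.
  by rewrite /= in_itv/= ltr_pdivlMr// => /negP; rewrite -leNgt; right.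
have mD : measurable (if l == 0%N then set0 else `]-oo, l%:R / n.+1%:R[%classic : set L).
  by case: ifP.
rewrite measureD//; last first.
  by apply: le_lt_trans (probability_le1 _ _) _; rewrite ?ltry.
rewrite [X in (X - _)%E](ray l.+1)// setIidr; last first.
  case: ifP => _ v //=; rewrite !in_itv/= => /lt_le_trans; apply.
  by rewrite ler_pM2r ?invr_gt0// ler_nat.
case: eqP => [->|_]; first by rewrite measure0 sube0 div1r.
rewrite [X in (_ - X)%E](ray l) ?(ltnW ln)// -EFinB; congr EFin.
by rewrite -mulrBl -(natr1 l) addrC addKr div1r.
Qed.

End uniform_pick.

Section ros.
Context {R : realType}.
Notation L := (measurableTypeR R).
Variables (rho : R) (rho_gt0 : 0 < rho) (b br : nat -> R) (t : R).
Notation S := (@streams R (source + nat)%type).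
Implicit Types (z : S) (x : ros_state (R := R)).

Definition ros_law (found_law : probability L R) (s : source + nat) : probability L R :=
  match s with
  | inl s => queue_law rho_gt0 found_law s
  | inr _ => uniform_prob (@ltr01 R)
  end.

Definition ros_run z m x : ros_state :=
  iter m (ros_step br (fun j => z (inl (Gap j))) (fun j => z (inl (Work j)))
    (fun j => z (inl (Mark j))) (fun j => z (inr j))) x.

Definition ros_served z m x : bool :=
  ros_started (ros_run z m x) && (ros_clock (ros_run z m x) <= t).

Definition ros_start n j k (c : R) z : ros_state :=
  ROSState c false (z (inl (Residual 0)))
    (mkseq (fun i => z (inl (Residual i.+1))) n) (z (inl (Gap 0))) j k.

Lemma ros_servedS z m x :
  ros_served z m.+1 x = ros_served z m (ros_step br (fun j => z (inl (Gap j)))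
    (fun j => z (inl (Work j))) (fun j => z (inl (Mark j))) (fun j => z (inr j)) x).
Proof. by rewrite /ros_served /ros_run iterSr. Qed.

Lemma ros_served_started z m x : ros_started x -> ros_served z m x = (ros_clock x <= t).
Proof.
move=> xd; rewrite /ros_served (_ : ros_run z m x = x) ?xd//.
by elim: m => //= m IH; rewrite /ros_run /= -/(ros_run z m x) IH /ros_step xd.
Qed.

Lemma ros_served_local z z' m x : z (inl (Work 0)) = z' (inl (Work 0)) ->
  (forall i, (ros_arrival x <= i)%N -> [/\ z (inl (Gap i)) = z' (inl (Gap i)),
     z (inl (Work i)) = z' (inl (Work i)) & z (inl (Mark i)) = z' (inl (Mark i))]) ->
  (forall i, (ros_completion x <= i)%N -> z (inr i) = z' (inr i)) ->
  ros_served z m x = ros_served z' m x.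
Proof.
move=> w0 zz' pz'; rewrite /ros_served (_ : ros_run z m x = ros_run z' m x)//.
elim: m x zz' pz' => // m IH x zz' pz'; rewrite /ros_run !iterSr.
have -> : ros_step br (fun j => z (inl (Gap j)))
    (fun j => z (inl (Work j))) (fun j => z (inl (Mark j))) (fun j => z (inr j)) x =
    ros_step br (fun j => z' (inl (Gap j)))
    (fun j => z' (inl (Work j))) (fun j => z' (inl (Mark j))) (fun j => z' (inr j)) x.
  by rewrite /ros_step w0 (pz' _ (leqnn _)); have [-> -> ->] := zz' _ (leqnn _).
apply: IH => i xi; [apply: zz'|apply: pz']; apply: leq_trans xi;
rewrite /ros_step; case: ifP => // _; case: ifP => //= _.
- by case: Num.truncn.
- by case: Num.truncn => //= *; exact: leqnSn.
Qed.

Lemma measurable_ros_served d (D : measurableType d) (z : D -> S) m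
    (x : D -> ros_state) : measurable_fun setT z -> ros_measurable x ->
  measurable [set w | ros_served (z w) m (x w)].
Proof.
move=> mz mx.
have mcoord (i : source + nat) : measurable_fun setT (fun w => z w i : L).
  exact: (measurableT_comp (@measurable_coord R _ i) mz).
have [mc mt _ _ _] := @ros_measurable_iter R _ D br (fun w j => z w (inl (Gap j)))
  (fun w j => z w (inl (Work j))) (fun w j => z w (inl (Mark j)))
  (fun w j => z w (inr j)) (fun j => mcoord _)
  (fun j => mcoord _) (fun j => mcoord _) (fun j => mcoord _) m _ mx.
suff : measurable_fun setT (fun w => ros_served (z w) m (x w)).
  by move=> /(_ measurableT [set true]); rewrite setTI; apply.
by apply: measurable_and => //; exact: measurable_fun_ler.
Qed.

Lemma measurable_ros_start m n j k (c : R) :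
  measurable [set z | ros_served z m (ros_start n j k c z)].
Proof.
have mcoord (i : source + nat) : measurable_fun setT (fun z : S => z i : L).
  exact: measurable_coord.
apply: measurable_ros_served; first exact: measurable_id.
split => //=.
by apply: (@measurable_seq_mkseq R _ S n (fun i z => z (inl (Residual i.+1)))).
Qed.

Lemma ros_step_arrival (gap work mark pick : nat -> R) c s w a j k : a < s ->
  ros_step br gap work mark pick (ROSState c false s w a j k) =
  ROSState (c + a) false (s - a)
    (if mark j < br (size w).+2 then rcons w (work j) else w) (gap j) j.+1 k.
Proof. by move=> sa; rewrite /ros_step /= leNgt sa. Qed.

Lemma ros_step_service (gap work mark pick : nat -> R) c s w a j k : s <= a ->
  ros_step br gap work mark pick (ROSState c false s w a j k) =
  if Num.truncn (pick k * (size w).+1%:R) is i.+1 then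
      ROSState (c + s) false (nth 0 w i) (take i w ++ drop i.+1 w) (a - s) j k.+1
    else ROSState (c + s) true (work 0%N) w (a - s) j k.+1.
Proof. by move=> sa; rewrite /ros_step /= sa. Qed.

Section law.
Hypothesis b01 : forall n, 0 <= b n <= 1.
Hypothesis brS : forall n, br n.+1 = b n.
Variables (found_law : probability L R) (Q : probability S R).
Hypothesis QP : product_law Q (ros_law found_law).

Definition ros_arrival_first : set S :=
  [set z | z (inl (Gap 0)) < z (inl (Residual 0))].

Definition picked n k l : set S := [set z | Num.truncn (z (inr k) * n.+1%:R) = l].

Lemma measurable_ros_arrival_first : measurable ros_arrival_first.
Proof.
have mcoord := @measurable_coord R (source + nat)%type.
suff mb : measurable_fun setT
    (fun z : S => z (inl (Gap 0)) < z (inl (Residual 0))).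
  by rewrite -[X in measurable X]setTI; apply: (mb _ [set true]).
by apply: measurable_fun_ltr; exact: mcoord.
Qed.

Lemma measurable_truncn_eq n l :
  measurable ([set v | Num.truncn (v * n.+1%:R) = l] : set L).
Proof.
suff mb : measurable_fun setT (fun v : L => Num.truncn (v * n.+1%:R)).
  by rewrite -[X in measurable X]setTI; apply: (mb _ [set l]).
by apply: measurable_truncn; exact: mulrr_measurable.
Qed.

Section step.
Variable m : nat.
Hypothesis IH : forall n j k c, (0 < j)%N ->
  Q [set z | ros_served z m (ros_start n j k c z)] = served_within rho_gt0 b t m n c.

(** Moving the chosen customer to the server is a renaming of the residuals that
    sends 0 to l + 1 and skips l + 1 afterwards. *)
Lemma ros_chosen n l j k c : (l < n)%N -> (0 < j)%N ->
  Q [set z | ros_served z m (ROSState c false (z (inl (Residual l.+1)))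
    (mkseq (fun q => z (inl (Residual (bump l q).+1))) n.-1) (z (inl (Gap 0))) j k)] =
  served_within rho_gt0 b t m n.-1 c.
Proof.
move=> ln j0; rewrite -(IH _ k _ j0).
pose r q := if q is q'.+1 then (bump l q').+1 else l.+1.
pose s (i : source + nat) :=
  if i is inl (Residual q) then inl (Residual (r q)) else i.
have r_inj : injective r.
  move=> [|p] [|q] //= []; first by move/eqP; rewrite (negbTE (neq_bump _ _)).
    by move/eqP; rewrite eq_sym (negbTE (neq_bump _ _)).
  by move/(can_inj (bumpK _)) ->.
rewrite -[RHS](product_law_relabel QP (s := s)).
- congr (Q _); apply/seteqP; split => z /=;
    by rewrite (@ros_served_local (relabel s z) z).
- by move=> [[|p|p|p|p]|p] [[|q|q|q|q]|q] //= [/r_inj ->].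
- by move=> [[]|].
- exact: measurable_ros_start.
Qed.

(** The pick is independent of the times, which gives the factor 1 / (n + 1)
    directly; the completion time is the residual of the customer in service,
    and the arrival clock restarts by memorylessness. *)
Lemma ros_service_term n l j k c : (l < n.+1)%N -> (0 < j)%N ->
  Q (([set z | ros_served z m.+1 (ros_start n j k c z)] `\` ros_arrival_first) `&`
     picked n k l) =
  ((n.+1%:R^-1)%:E * \int[exp_law (@ltr01 R)]_(s in `]0%R, +oo[)
     ((expR (- rho * s))%:E *
      after_service t (served_within rho_gt0 b t m) n l (c + s)))%E.
Proof.
move=> ln j0.
have mid : measurable_fun setT (@id S) by exact: measurable_id.
have mcoord (i : source + nat) : measurable_fun setT (fun z : S => z i : L).
  exact: measurable_coord.
pose st l' s z := ROSState (c + s) false (z (inl (Residual l'.+1)))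
    (mkseq (fun q => z (inl (Residual (bump l' q).+1))) n.-1) (z (inl (Gap 0))) j k.+1.
pose B l0 s : set S := if l0 is l'.+1 then [set z | ros_served z m (st l' s z)]
  else if c + s <= t then setT else set0.
have mst l' (s : R) : ros_measurable (fun z : S => st l' s z).
  split => //=.
  by apply: (@measurable_seq_mkseq R _ S n.-1
    (fun i z => z (inl (Residual (bump l' i).+1)))).
have mB s : measurable (B l s).
  rewrite /B; case: (l) => [|l']; first by case: ifP.
  exact: measurable_ros_served.
have QB s : Q (B l s) = after_service t (served_within rho_gt0 b t m) n l (c + s).
  rewrite /B /after_service; case: (l) ln => [_|l' ln].
    by case: ifP; rewrite ?probability_setT ?measure0.
  exact: ros_chosen.
pose stC l' z := ROSState (c + z (inl (Residual 0))) false (z (inl (Residual l'.+1)))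
  (mkseq (fun q => z (inl (Residual (bump l' q).+1))) n.-1)
  (z (inl (Gap 0)) - z (inl (Residual 0))) j k.+1.
pose C0 l0 z : bool := if l0 is l'.+1 then ros_served z m (stC l' z)
  else c + z (inl (Residual 0)) <= t.
pose C : set S := [set z | z (inl (Residual 0)) <= z (inl (Gap 0)) /\ C0 l z].
have mC : measurable C.
  apply: measurableI.
    suff mb : measurable_fun setT
        (fun z : S => z (inl (Residual 0)) <= z (inl (Gap 0))).
      by rewrite -[X in measurable X]setTI; apply: (mb _ [set true]).
    by apply: measurable_fun_ler; exact: mcoord.
  rewrite /C0; case: (l) => [|l'].
    suff mb : measurable_fun setT (fun z : S => c + z (inl (Residual 0)) <= t).
      by rewrite -[X in measurable X]setTI; apply: (mb _ [set true]).
    by apply: measurable_fun_ler => //; apply: measurable_funD => //; exact: mcoord.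
  apply: measurable_ros_served => //; split => //=; last split => //=.
  - by apply: measurable_funD => //; exact: mcoord.
  - by apply: (@measurable_seq_mkseq R _ S n.-1
      (fun i z => z (inl (Residual (bump l' i).+1)))).
  - by apply: measurable_funB; exact: mcoord.
have ACE : ([set z | ros_served z m.+1 (ros_start n j k c z)] `\` ros_arrival_first)
    `&` picked n k l = [set z | [set v | Num.truncn (v * n.+1%:R) = l] (z (inr k))] `&` C.
  rewrite setIC; apply/seteqP.
  suff step z : Num.truncn (z (inr k) * n.+1%:R) = l ->
      z (inl (Residual 0)) <= z (inl (Gap 0)) ->
      ros_served z m.+1 (ros_start n j k c z) = C0 l z.
    split => z /=.
      move=> [pz [Az /negP]]; rewrite -leNgt => sz; split => //; split => //.
      by rewrite -step.
    move=> [pz [sz Cz]]; split => //; split; first by rewrite step.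
    by apply/negP; rewrite -leNgt.
  move=> pz sz; rewrite ros_servedS ros_step_service// size_mkseq pz /C0.
  case: l ln {mB QB C mC pz} => [|l'] ln; first by rewrite ros_served_started.
  rewrite nth_mkseq// take_drop_mkseq//.
rewrite ACE (independent_coord QP (measurable_truncn_eq n l) mC); last first.
  move=> z x; rewrite /C /= /C0 !upd_neq//.
  case: (l) => [|l']; first by [].
  rewrite (@ros_served_local _ z)//= => i ki.
  by rewrite upd_neq//; apply/eqP => -[ik]; rewrite ik ltnn in ki.
rewrite [X in (X * _)%E](_ : _ = (n.+1%:R^-1)%:E); last exact: uniform_prob_truncn.
congr (_ * _)%E.
rewrite (resample_pos QP (rate_gt0 := @ltr01 R) (i := inl (Residual 0)))//.
apply: eq_integral => s; rewrite inE/= in_itv/= andbT => s0.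
rewrite -QB.
pose A1 : set S := [set z | z (inl (Gap 0)) \in Interval (BSide true s) +oo%O /\
  B l s (upd z (inl (Gap 0)) (z (inl (Gap 0)) - s))].
have QA1 : Q A1 = ((expR (- rho * s))%:E * Q (B l s))%E.
  by apply: (memoryless_coord QP (rate_gt0 := rho_gt0)) => //; exact: ltW.
rewrite -QA1; congr (Q _); apply/seteqP.
suff CB z : C0 l (upd z (inl (Residual 0)) s) <->
    B l s (upd z (inl (Gap 0)) (z (inl (Gap 0)) - s)).
  split => z /=; rewrite /C /A1 /= in_itv/= andbT upd_eq upd_neq// => -[sz ?];
  by split => //; apply/CB.
rewrite /C0 /B; case: (l) => [|l'].
  by rewrite upd_eq; case: ifP.
rewrite /stC /st /= !upd_eq !upd_neq//.
rewrite (@ros_served_local _ (upd z (inl (Gap 0)) (z (inl (Gap 0)) - s)))//=.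
move=> i ji; have i0 : i != 0%N by rewrite -lt0n (leq_trans j0).
by rewrite !upd_neq.
Qed.

(** As in processor sharing, with the residuals shifted by one, since number 0
    is in service. *)
Lemma ros_admitted n j k c : (0 < j)%N ->
  Q [set z | ros_served z m (ROSState c false (z (inl (Residual 0)))
      (rcons (mkseq (fun i => z (inl (Residual i.+1))) n) (z (inl (Work j))))
      (z (inl (Gap j))) j.+1 k)] =
  served_within rho_gt0 b t m n.+1 c.
Proof.
move=> j0; rewrite -(IH _ k _ (ltn0Sn j)).
pose s (i : source + nat) := match i with
  | inl (Residual q) => if q == n.+1 then inl (Work j) else i
  | inl (Work q) => if q == j then inl (Residual n.+1) else i
  | inl (Gap q) =>
      if q == 0%N then inl (Gap j) else if q == j then inl (Gap 0) else i
  | _ => i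
  end.
have sK : involutive s.
  move=> [[|q|q|q|q]|q] //=.
  - by case: eqP => [->|/eqP/negbTE qn] /=; rewrite ?eqxx ?qn.
  - case: (eqVneq q 0%N) => [->|q0] /=; first by rewrite eqxx gtn_eqF.
    by case: eqP => [->|/eqP/negbTE qj] /=; rewrite ?eqxx// (negbTE q0) qj.
  - by case: eqP => [->|/eqP/negbTE qj] /=; rewrite ?eqxx ?qj.
rewrite -[RHS](product_law_relabel QP (s := s)).
- congr (Q _); apply/seteqP.
  suff zs z : ros_served z m (ROSState c false (z (inl (Residual 0)))
      (rcons (mkseq (fun i => z (inl (Residual i.+1))) n) (z (inl (Work j))))
      (z (inl (Gap j))) j.+1 k) =
      ros_served (relabel s z) m (ros_start n.+1 j.+1 k c (relabel s z)).
    by split => z /=; rewrite zs.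
  rewrite (@ros_served_local z (relabel s z))//.
  + congr (ros_served _ _ (ROSState _ _ _ _ _ _ _)); rewrite /relabel /=.
    rewrite mkseqS /= eqxx; congr rcons; apply/eq_in_map => q.
    by rewrite mem_iota /= add0n => qn; rewrite eqSS ltn_eqF.
  + by rewrite /relabel /= ltn_eqF.
  + move=> i /= ji; rewrite /relabel /=.
    by rewrite (gtn_eqF ji) (gtn_eqF (ltn_trans j0 ji)).
- exact: inv_inj.
- by move=> [[]|] //= q; case: ifP => //; case: ifP.
- exact: measurable_ros_start.
Qed.

Lemma ros_balked n j k c : (0 < j)%N ->
  Q [set z | ros_served z m (ROSState c false (z (inl (Residual 0)))
      (mkseq (fun i => z (inl (Residual i.+1))) n) (z (inl (Gap j))) j.+1 k)] =
  served_within rho_gt0 b t m n c.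
Proof.
move=> j0; rewrite -(IH _ k _ (ltn0Sn j)).
pose s (i : source + nat) := if i is inl (Gap q) then
  if q == 0%N then inl (Gap j) else if q == j then inl (Gap 0) else i else i.
have sK : involutive s.
  move=> [[|q|q|q|q]|q] //=.
  case: (eqVneq q 0%N) => [->|q0] /=; first by rewrite eqxx gtn_eqF.
  by case: eqP => [->|/eqP/negbTE qj] /=; rewrite ?eqxx// (negbTE q0) qj.
rewrite -[RHS](product_law_relabel QP (s := s)).
- congr (Q _); apply/seteqP.
  suff zs z : ros_served z m (ROSState c false (z (inl (Residual 0)))
      (mkseq (fun i => z (inl (Residual i.+1))) n) (z (inl (Gap j))) j.+1 k) =
      ros_served (relabel s z) m (ros_start n j.+1 k c (relabel s z)).
    by split => z /=; rewrite zs.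
  rewrite (@ros_served_local z (relabel s z))// => i /= ji; rewrite /relabel /=.
  by rewrite (gtn_eqF ji) (gtn_eqF (ltn_trans j0 ji)).
- exact: inv_inj.
- by move=> [[]|] //= q; case: ifP => //; case: ifP.
- exact: measurable_ros_start.
Qed.

(** Only the customer in service is being served, so a single requirement must
    exceed the arrival time, again with probability exp(- a).  The arrival finds
    n + 2 customers, which is where br n.+2 = b n.+1 enters. *)
Lemma ros_arrival_term n j k c : (0 < j)%N ->
  Q ([set z | ros_served z m.+1 (ros_start n j k c z)] `&` ros_arrival_first) =
  (\int[exp_law rho_gt0]_(a in `]0%R, +oo[)
     ((expR (- a))%:E * ((b n.+1)%:E * served_within rho_gt0 b t m n.+1 (c + a) +
        (1 - b n.+1)%:E * served_within rho_gt0 b t m n (c + a))))%E.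
Proof.
move=> j0.
have mid : measurable_fun setT (@id S) by exact: measurable_id.
have mcoord (i : source + nat) : measurable_fun setT (fun z : S => z i : L).
  exact: measurable_coord.
have mA : measurable [set z | ros_served z m.+1 (ros_start n j k c z)].
  exact: measurable_ros_start.
rewrite (resample_pos QP (rate_gt0 := rho_gt0) (i := inl (Gap 0)))//; last first.
  by apply: measurableI => //; exact: measurable_ros_arrival_first.
apply: eq_integral => a; rewrite inE/= in_itv/= andbT => a0.
have mres : measurable_seq (fun z : S => mkseq (fun i => z (inl (Residual i.+1))) n).
  by apply: (@measurable_seq_mkseq R _ S n (fun i z => z (inl (Residual i.+1)))).
pose joined z := ROSState (c + a) false (z (inl (Residual 0)))
  (rcons (mkseq (fun i => z (inl (Residual i.+1))) n) (z (inl (Work j))))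
  (z (inl (Gap j))) j.+1 k.
pose balked z := ROSState (c + a) false (z (inl (Residual 0)))
  (mkseq (fun i => z (inl (Residual i.+1))) n) (z (inl (Gap j))) j.+1 k.
pose A1 : set S := [set z | ros_served z m (joined z)].
pose A2 : set S := [set z | ros_served z m (balked z)].
have mA1 : measurable A1.
  by apply: measurable_ros_served => //; split => //=; exact: measurable_seq_rcons.
have mA2 : measurable A2 by apply: measurable_ros_served => //; split => //=.
pose M1 : set S := [set z | `]-oo, b n.+1[%classic (z (inl (Mark j)))].
pose M2 : set S := [set z | (~` `]-oo, b n.+1[%classic) (z (inl (Mark j)))].
have mB : measurable (`]-oo, b n.+1[%classic : set L) by exact: measurable_itv.
have mM1 : measurable M1.
  by rewrite -[X in measurable X]setTI; exact: (mcoord (inl (Mark j))).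
have mM2 : measurable M2.
  rewrite -[X in measurable X]setTI; apply: (mcoord (inl (Mark j))) => //.
  exact: measurableC.
pose A' : set S := (M1 `&` A1) `|` (M2 `&` A2).
have mA' : measurable A' by apply: measurableU; exact: measurableI.
transitivity (Q [set z | z (inl (Residual 0)) \in Interval (BSide false a) +oo%O /\
    A' (upd z (inl (Residual 0)) (z (inl (Residual 0)) - a))]).
  congr (Q _); apply/seteqP.
  suff Az z : a < z (inl (Residual 0)) ->
      ros_served (upd z (inl (Gap 0)) a) m.+1 (ros_start n j k c (upd z (inl (Gap 0)) a)) <->
      A' (upd z (inl (Residual 0)) (z (inl (Residual 0)) - a)).
    split => z /=; rewrite in_itv/= andbT /ros_arrival_first /= upd_eq upd_neq//.
      by move=> [Az' az]; split => //; apply/Az.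
    by move=> [az Az']; split => //; apply/Az.
  move=> az; rewrite ros_servedS /ros_start upd_eq ros_step_arrival ?upd_neq//.
  set y := upd z (inl (Residual 0)) _.
  have loc st : ros_arrival st = j.+1 ->
      ros_served (upd z (inl (Gap 0)) a) m st = ros_served y m st.
    move=> stj; apply: ros_served_local => // i; rewrite stj => ji.
    rewrite /y; split; rewrite !upd_neq//.
    by apply/eqP => -[i0]; rewrite i0 in ji.
  rewrite loc//= size_mkseq brS.
  rewrite [X in _ <-> X](_ : _ = ((y (inl (Mark j)) < b n.+1) /\ A1 y \/
      ~ (y (inl (Mark j)) < b n.+1) /\ A2 y)); last first.
    by rewrite /A' /M1 /M2 /setU /setI /= in_itv.
  rewrite /A1 /A2 /joined /balked /= /y !upd_eq !upd_neq//.
  by case: ifP => zb; intuition.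
  by apply/eqP => -[j00]; rewrite j00 in j0.
have mem : Q [set z | z (inl (Residual 0)) \in Interval (BSide false a) +oo%O /\
    A' (upd z (inl (Residual 0)) (z (inl (Residual 0)) - a))] =
    ((expR (- 1 * a))%:E * Q A')%E.
  by apply: (memoryless_coord QP (rate_gt0 := @ltr01 R)) => //; exact: ltW.
apply: etrans mem _; rewrite mulN1r; congr (_ * _)%E.
have /andP[b0 b1] := b01 n.+1.
have mark_law : (uniform_prob (@ltr01 R) `]-oo, b n.+1[%classic = (b n.+1)%:E)%E.
  exact: uniform_prob_ray.
have Q1 : Q (M1 `&` A1) = ((b n.+1)%:E * served_within rho_gt0 b t m n.+1 (c + a))%E.
  rewrite -(ros_admitted _ k _ j0) -mark_law.
  apply: (independent_coord QP mB mA1) => z x; rewrite /A1 /joined /= !upd_neq//.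
  rewrite (@ros_served_local _ z)// => i ji; split; rewrite upd_neq//.
  by apply/eqP => -[ij]; rewrite ij /= ltnn in ji.
have Q2 : Q (M2 `&` A2) = ((1 - b n.+1)%:E * served_within rho_gt0 b t m n (c + a))%E.
  rewrite -(ros_balked _ k _ j0) EFinB -mark_law.
  transitivity (ros_law found_law (inl (Mark j))
    (~` `]-oo, b n.+1[%classic) * Q A2)%E.
    apply: (independent_coord QP (measurableC mB) mA2) => z x.
    rewrite /A2 /balked /= !upd_neq//.
    rewrite (@ros_served_local _ z)// => i ji; split; rewrite upd_neq//.
    by apply/eqP => -[ij]; rewrite ij /= ltnn in ji.
  by rewrite probability_setC.
rewrite -Q1 -Q2; apply: measureU; [exact: measurableI|exact: measurableI|].
by apply/seteqP; split => z // [[? _] [? _]].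
Qed.

End step.

(** A pick that is not below 1 would designate a customer beyond the end of the list. *)
Definition overpicked k : set S := [set z | (~` `]-oo, 1%R[%classic) (z (inr k))].

Lemma overpicked_negligible k : Q.-negligible (overpicked k).
Proof.
have mB : measurable (`]-oo, 1%R[%classic : set L) by exact: measurable_itv.
apply/negligibleP.
  rewrite -[X in measurable X]setTI; apply: (@measurable_coord R _ (inr k)) => //.
  exact: measurableC.
transitivity (Q ([set z | (~` `]-oo, 1%R[%classic) (z (inr k))] `&` setT)).
  by rewrite setIT.
have := independent_coord QP (measurableC mB) (i := inr k) (measurableT : measurable (setT : set S)).
move=> -> //=; rewrite probability_setT mule1 probability_setC//.
rewrite [X in (1 - X)%E](_ : _ = 1%E) ?subee//.
by apply: etrans (uniform_prob_ray _) _; rewrite ?ler01 ?lexx.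
Qed.

Lemma measurable_picked n k l : measurable (picked n k l).
Proof.
rewrite -[X in measurable X]setTI.
exact: (@measurable_coord R _ (inr k) measurableT _ (measurable_truncn_eq n l)).
Qed.

Lemma ros_served_law m n j k c : (0 < j)%N ->
  Q [set z | ros_served z m (ros_start n j k c z)] = served_within rho_gt0 b t m n c.
Proof.
elim: m n j k c => [|m IH] n j k c j0.
  by rewrite (_ : mkset _ = set0) ?measure0//; apply/seteqP; split.
set A := [set z | ros_served z m.+1 (ros_start n j k c z)].
have mA : measurable A by exact: measurable_ros_start.
have marr := measurable_ros_arrival_first.
rewrite (measureDI Q mA marr) /=; congr (_ + _)%E; last exact: ros_arrival_term.
rewrite (measure_partition (D := fun l : 'I_n.+1 => picked n k l)
  (N := overpicked k)).
- by apply: eq_bigr => l _; exact: ros_service_term.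
- exact: measurableD.
- by move=> l; exact: measurable_picked.
- exact: overpicked_negligible.
- by move=> l l' z lz l'z; apply/val_inj; exact: etrans (esym lz) l'z.
- move=> z _; have [z1|z1] := ltP (z (inr k)) 1; last first.
    by left; rewrite /overpicked /= in_itv/=; apply/negP; rewrite -leNgt.
  right; have zn : (Num.truncn (z (inr k) * n.+1%:R) < n.+1)%N.
    rewrite ltnS leqNgt truncn_gt_nat -ltNge -[ltRHS]mul1r.
    by rewrite ltr_pM2r ?ltr0n.
  by exists (Ordinal zn).
Qed.

End law.
End ros.

(** * From paths to distribution functions *)

Section absorption.
Context {R : realType} (S : Type).
Variables (step : S -> S) (clock : S -> R) (final : S -> bool).
Hypothesis final_step : forall x, final x -> step x = x.

Lemma iter_final x m m' : final (iter m step x) -> (m <= m')%N ->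
  iter m' step x = iter m step x.
Proof.
move=> fm /subnK <-; elim: (m' - m)%N => // k IH.
by rewrite addSn iterS IH final_step.
Qed.

(** Final states are fixed by [step], so the clocks over which the infimum is
    taken are all equal and the infimum is attained when the set is inhabited. *)
Lemma absorption_time_le x (t : R) :
  (absorption_time step clock final x <= t%:E)%E <->
  exists m, final (iter m step x) && (clock (iter m step x) <= t).
Proof.
have [[m fm]|nf] := pselect (exists m, final (iter m step x)); last first.
  split=> [|[m /andP[fm _]]]; last by case: nf; exists m.
  rewrite /absorption_time (_ : mkset _ = set0) ?image_set0 ?ereal_inf0//.
  by apply/seteqP; split => // m /= fm; case: nf; exists m.
have eqm m' : final (iter m' step x) -> iter m' step x = iter m step x.
  by move=> fm'; have [mm'|/ltnW m'm] := leqP m m';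
    [exact: iter_final|rewrite -(iter_final fm' m'm)].
have -> : absorption_time step clock final x = (clock (iter m step x))%:E.
  rewrite /absorption_time (_ : image _ _ = [set (clock (iter m step x))%:E]).
    by rewrite ereal_inf1.
  apply/seteqP; split => [_ [m' /= fm' <-]|_ /= ->]; first by rewrite eqm.
  by exists m.
rewrite lee_fin; split=> [ct|[m' /andP[fm' ct]]]; last by rewrite -(eqm m').
by exists m; rewrite fm.
Qed.

End absorption.

Section image_probability.
Context d d' (T : measurableType d) (T' : measurableType d') (R : realType).
Variables (P : probability T R) (f : T -> T') (mf : measurable_fun setT f).

Fact image_probability_subproof :
  {Q : probability T' R | forall A, Q A = P (f @^-1` A)}.
Proof.
pose F : {mfun T >-> T'} := HB.pack f (isMeasurableFun.Build _ _ _ _ f mf).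
by exists (distribution P F).
Qed.

Definition image_probability : probability T' R := sval image_probability_subproof.

Lemma image_probabilityE A : image_probability A = P (f @^-1` A).
Proof. exact: (svalP image_probability_subproof). Qed.

End image_probability.

Section stream_law.
Context {R : realType} d (T : measurableType d) (P : probability T R) (I : eqType).
Notation L := (measurableTypeR R).
Variables (Z : I -> T -> R) (mZ : forall i, measurable_fun setT (Z i : T -> L)).

Definition stream (w : T) : @streams R I := fun i => Z i w.

Lemma measurable_stream : measurable_fun setT stream.
Proof. exact: measurable_to_streams. Qed.

Definition stream_law : probability (@streams R I) R :=
  image_probability P measurable_stream.

Lemma stream_lawE A : stream_law A = P (stream @^-1` A).
Proof. exact: image_probabilityE. Qed.

Lemma product_law_stream (mu : I -> probability L R) :
  mutually_independent P Z -> (forall i, has_law P (Z i) (mu i)) ->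
  product_law stream_law mu.
Proof.
move=> indZ lawZ k i B i_inj mB; rewrite stream_lawE.
transitivity (\prod_(l < k) P (Z (i l) @^-1` B l))%E; last first.
  by apply: eq_bigr => l _; apply: lawZ; exact: mB.
exact: indZ.
Qed.

End stream_law.

Section laws_on_ereal.
Context {R : realType}.

Lemma measurable_fun_ereal_le d (T : measurableType d) (X : T -> \bar R) :
  (forall t : R, measurable [set w | (X w <= t%:E)%E]) -> measurable_fun setT X.
Proof.
move=> mX; apply: (measurability _ (ErealGenOInfty.measurableE R)).
move=> _ [_ [r ->] <-]; rewrite setTI (_ : _ @^-1` _ = ~` [set w | (X w <= r%:E)%E]).
  exact: measurableC.
by apply/seteqP; split => w /=; rewrite in_itv/= andbT ltNge => /negP.
Qed.

(** Distribution functions at real points determine a law on the extended reals: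
    the rays above real points, together with the whole space, are stable under
    intersection and generate the sigma-algebra. *)
Lemma eq_in_law_le d (T : measurableType d) (P : probability T R)
    d' (T' : measurableType d') (P' : probability T' R)
    (X : T -> \bar R) (X' : T' -> \bar R) :
  (forall t : R, measurable [set w | (X w <= t%:E)%E]) ->
  (forall t : R, measurable [set w | (X' w <= t%:E)%E]) ->
  (forall t : R, P [set w | (X w <= t%:E)%E] = P' [set w | (X' w <= t%:E)%E]) ->
  eq_in_law P P' X X'.
Proof.
move=> mX mX' PP'.
have mfX := measurable_fun_ereal_le mX; have mfX' := measurable_fun_ereal_le mX'.
split=> // B mB.
pose G : set (set (\bar R)) := [set A | A = setT \/ ErealGenOInfty.G A].
have GE A : G A -> P (X @^-1` A) = P' (X' @^-1` A).
  case=> [->|[r ->]]; first by rewrite !preimage_setT !probability_setT.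
  rewrite (_ : X @^-1` _ = ~` [set w | (X w <= r%:E)%E]); last first.
    by apply/seteqP; split => w /=; rewrite in_itv/= andbT ltNge => /negP.
  rewrite (_ : X' @^-1` _ = ~` [set w | (X' w <= r%:E)%E]); last first.
    by apply/seteqP; split => w /=; rewrite in_itv/= andbT ltNge => /negP.
  by rewrite !probability_setC// PP'.
transitivity (image_measure P mfX B) => //.
transitivity (image_measure P' mfX' B) => //.
apply: (@measure_unique _ R _ G (fun=> setT)) mB => //.
- have := ErealGenOInfty.measurableE R; rewrite -[X in X = _ -> _]/(@measurable _ (\bar R)) => ->.
  apply/seteqP; split.
    apply: smallest_sub; first exact: smallest_sigma_algebra.
    by move=> A GA; apply: sub_sigma_algebra; right.
  apply: smallest_sub; first exact: smallest_sigma_algebra.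
  move=> A [->|GA]; last exact: sub_sigma_algebra.
  exact: (@measurableT _ (g_sigma_algebraType (@ErealGenOInfty.G R))).
- move=> _ _ [->|[r ->]] [->|[s ->]]; rewrite ?setIT ?setTI; [by left|by right; exists s|by right; exists r|].
  right; exists (Num.max r s); apply/seteqP; split => x /=; rewrite !in_itv/= !andbT EFin_max gt_max.
    by move=> [-> ->].
  by move=> /andP[].
- by move=> _; left.
- by apply/seteqP; split => // x _; exists 0%N.
- by move=> _; rewrite [X in (X < _)%E](_ : _ = 1%E) ?ltry//; exact: probability_setT.
Qed.

End laws_on_ereal.

Section paths.
Context {R : realType}.
Notation L := (measurableTypeR R).
Variables (rho : R) (rho_gt0 : 0 < rho) (b br : nat -> R).
Hypothesis b01 : forall n, 0 <= b n <= 1.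
Hypothesis brS : forall n, br n.+1 = b n.
Variable (found_law : probability L R).

Definition ps_sojourn_of n (z : @streams R source) : \bar R :=
  ps_sojourn_path b (fun i => z (Residual i)) (fun j => z (Gap j))
    (fun j => z (Work j)) (fun j => z (Mark j)) n.

Definition ros_wait_of n (z : @streams R (source + nat)%type) : \bar R :=
  ros_wait_path br (fun i => z (inl (Residual i))) (fun j => z (inl (Gap j)))
    (fun j => z (inl (Work j))) (fun j => z (inl (Mark j))) (fun c => z (inr c)) n.

Lemma ps_sojourn_le n z (t : R) : (ps_sojourn_of n z <= t%:E)%E <->
  exists m, ps_left b t z m (ps_start n 1 0 z).
Proof. by apply: absorption_time_le => x xd; rewrite /ps_step xd. Qed.

Lemma ros_wait_le n z (t : R) : (ros_wait_of n z <= t%:E)%E <->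
  exists m, ros_served br t z m (ros_start n 1 0 0 z).
Proof. by apply: absorption_time_le => x xd; rewrite /ros_step xd. Qed.

Lemma measurable_ps_sojourn_le n (t : R) :
  measurable [set z | (ps_sojourn_of n z <= t%:E)%E].
Proof.
rewrite (_ : mkset _ = \bigcup_m [set z | ps_left b t z m (ps_start n 1 0 z)]).
  by apply: bigcupT_measurable => m; exact: measurable_ps_start.
apply/seteqP; split => z /=; first by move=> /ps_sojourn_le[m lm]; exists m.
by move=> [m _ lm]; apply/ps_sojourn_le; exists m.
Qed.

Lemma measurable_ros_wait_le n (t : R) :
  measurable [set z | (ros_wait_of n z <= t%:E)%E].
Proof.
rewrite (_ : mkset _ = \bigcup_m [set z | ros_served br t z m (ros_start n 1 0 0 z)]).
  by apply: bigcupT_measurable => m; exact: measurable_ros_start.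
apply/seteqP; split => z /=; first by move=> /ros_wait_le[m lm]; exists m.
by move=> [m _ lm]; apply/ros_wait_le; exists m.
Qed.

(** The events of being absorbed within m events increase to absorption, so their
    probabilities converge. *)
Lemma ps_sojourn_cdf (Q : probability (@streams R source) R) n (t : R) :
  product_law Q (queue_law rho_gt0 found_law) ->
  Q [set z | (ps_sojourn_of n z <= t%:E)%E] =
  limn (fun m => served_within rho_gt0 b t m n 0).
Proof.
move=> QP; pose A m := [set z | ps_left b t z m (ps_start n 1 0 z)].
have mA m : measurable (A m) by exact: measurable_ps_start.
transitivity (limn (Q \o A)).
  rewrite (_ : mkset _ = \bigcup_m A m).
    apply/esym/cvg_lim => //; apply: nondecreasing_cvg_mu => //.
      exact: bigcupT_measurable.
    move=> m m' mm'; apply/subsetPset => z; rewrite /A /= /ps_left => /andP[dm ct].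
    by rewrite /ps_run !(iter_final _ dm mm') ?dm// => x xd; rewrite /ps_step xd.
  apply/seteqP; split => z /=; first by move=> /ps_sojourn_le[m lm]; exists m.
  by move=> [m _ lm]; apply/ps_sojourn_le; exists m.
by congr (limn _); apply/funext => m /=; exact: (ps_left_law t b01 QP m n 0 (ltn0Sn 0)).
Qed.

Lemma ros_wait_cdf (Q : probability (@streams R (source + nat)%type) R) n (t : R) :
  product_law Q (ros_law rho_gt0 found_law) ->
  Q [set z | (ros_wait_of n z <= t%:E)%E] =
  limn (fun m => served_within rho_gt0 b t m n 0).
Proof.
move=> QP; pose A m := [set z | ros_served br t z m (ros_start n 1 0 0 z)].
have mA m : measurable (A m) by exact: measurable_ros_start.
transitivity (limn (Q \o A)).
  rewrite (_ : mkset _ = \bigcup_m A m).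
    apply/esym/cvg_lim => //; apply: nondecreasing_cvg_mu => //.
      exact: bigcupT_measurable.
    move=> m m' mm'; apply/subsetPset => z; rewrite /A /= /ros_served => /andP[dm ct].
    by rewrite /ros_run !(iter_final _ dm mm') ?dm// => x xd; rewrite /ros_step xd.
  apply/seteqP; split => z /=; first by move=> /ros_wait_le[m lm]; exists m.
  by move=> [m _ lm]; apply/ros_wait_le; exists m.
by congr (limn _); apply/funext => m /=; exact: (ros_served_law t b01 brS QP m n 0 0 (ltn0Sn 0)).
Qed.

(** The number found and the mark of the tagged customer do not influence its
    path once n is given; hence they are independent of its sojourn time. *)
Lemma ps_sojourn_le_upd n z i x (t : R) : i = Defs.Found \/ i = Mark 0 ->
  (ps_sojourn_of n (upd z i x) <= t%:E)%E <-> (ps_sojourn_of n z <= t%:E)%E.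
Proof.
move=> iE.
have leftE m : ps_left b t (upd z i x) m (ps_start n 1 0 (upd z i x)) =
    ps_left b t z m (ps_start n 1 0 z).
  rewrite (@ps_left_local _ b t (upd z i x) z); first by case: iE => ->.
  by case: iE => -> [|q] //= _; rewrite !upd_neq.
by rewrite !ps_sojourn_le; split => -[m lm]; exists m; rewrite -?leftE// leftE.
Qed.

Lemma ros_wait_le_upd n z i x (t : R) : i = inl Defs.Found \/ i = inl (Mark 0) ->
  (ros_wait_of n (upd z i x) <= t%:E)%E <-> (ros_wait_of n z <= t%:E)%E.
Proof.
move=> iE.
have leftE m : ros_served br t (upd z i x) m (ros_start n 1 0 0 (upd z i x)) =
    ros_served br t z m (ros_start n 1 0 0 z).
  rewrite (@ros_served_local _ br t (upd z i x) z); first by case: iE => ->.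
  - by case: iE => ->; rewrite upd_neq.
  - by case: iE => -> [|q] //= _; rewrite !upd_neq.
  - by case: iE => -> q _; rewrite upd_neq.
by rewrite !ros_wait_le; split => -[m lm]; exists m; rewrite -?leftE// leftE.
Qed.

End paths.

Section series.
Context {R : realType}.

Lemma nneseries_limn (u : nat -> R) : (forall n, 0 <= u n) -> u 0%N = 1 ->
  cvgn (fun N => \sum_(1 <= n < N) u n) ->
  (\sum_(0 <= n <oo) (u n)%:E = (1 + limn (fun N => \sum_(1 <= n < N) u n))%:E)%E.
Proof.
move=> u0 u01 cu; rewrite (nneseries_split 0%N 1%N); last by move=> n _; rewrite lee_fin.
rewrite big_nat1 u01 EFinD; congr (_ + _)%E.
rewrite -EFin_lim//; congr (limn _); apply/funext => N /=.
by rewrite sumEFin.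
Qed.

End series.

(** * Averaging over the number of customers found *)

Section found.
Context {R : realType} d (T : measurableType d) (P : probability T R) (I : eqType).
Notation L := (measurableTypeR R).
Variables (found : T -> nat) (mfound : measurable_fun setT found).
Variables (Z : I -> T -> R) (mZ : forall i, measurable_fun setT (Z i : T -> L)).
Variables (mu : I -> probability L R) (iF iM : I).
Hypothesis ZF : forall w, Z iF w = (found w)%:R.
Hypothesis iFM : iF != iM.
Hypothesis QP : product_law (stream_law P mZ) mu.
Hypothesis muM : forall B : set L, measurable B -> mu iM B = uniform_prob (@ltr01 R) B.

(** On the event that n customers are found, the steady-state event concerns the
    path from an initial state fixed by n, and this path uses neither the number
    found nor the mark of the tagged customer. *)
Lemma sum_over_found (b : nat -> R) (E : nat -> set (@streams R I)) :
  (forall n, 0 <= b n <= 1) -> (forall n, measurable (E n)) ->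
  (forall n z x, E n (upd z iF x) <-> E n z) ->
  (forall n z x, E n (upd z iM x) <-> E n z) ->
  P [set w | E (found w) (stream Z w) /\ Z iM w < b (found w)] =
  (\sum_(0 <= n <oo) (P (found @^-1` [set n]) * ((b n)%:E * stream_law P mZ (E n))))%E.
Proof.
move=> b01 mE EF EM.
have mZi (i : I) (B : set L) : measurable B -> measurable (Z i @^-1` B).
  by move=> mB; rewrite -[X in measurable X]setTI; exact: mZ.
have mfn n : measurable (found @^-1` [set n]).
  by rewrite -[X in measurable X]setTI; exact: mfound.
have mray x : measurable (`]-oo, x[%classic : set L) by exact: measurable_itv.
pose F n := found @^-1` [set n] `&`
  (Z iM @^-1` `]-oo, b n[%classic `&` stream Z @^-1` E n).
have mF n : measurable (F n).
  apply: measurableI => //; apply: measurableI; first exact: mZi.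
  by rewrite -[X in measurable X]setTI; apply: (measurable_stream mZ).
rewrite (_ : mkset _ = \bigcup_n F n); last first.
  apply/seteqP; split => w /=.
    by move=> [Ew Mw]; exists (found w) => //; split => //; split => //=; rewrite in_itv.
  by move=> [n _ [/= -> [/=]]]; rewrite in_itv.
rewrite measure_semi_bigcup//; last 2 first.
- apply/trivIsetP => i j _ _ ij; apply/seteqP; split => w // [[/= wi _] [/= wj _]].
  by rewrite -wi -wj eqxx in ij.
- exact: bigcupT_measurable.
apply: eq_eseriesr => n _.
have mset1 : measurable ([set n%:R] : set L) by exact: measurable_set1.
have mM : measurable ([set z | `]-oo, b n[%classic (z iM)] : set (@streams R I)).
  by rewrite -[X in measurable X]setTI; exact: (@measurable_coord R I iM).
transitivity (stream_law P mZ ([set z | [set n%:R] (z iF)] `&`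
    ([set z | `]-oo, b n[%classic (z iM)] `&` E n))).
  rewrite stream_lawE; congr (P _); apply/seteqP; split => w [/= fw [Mw Ew]];
    split => //=; last 1 first.
  - by move: fw; rewrite /stream ZF => /eqP; rewrite eqr_nat => /eqP.
  - by rewrite /stream ZF fw.
have Qn : stream_law P mZ ([set z | `]-oo, b n[%classic (z iM)] `&` E n) =
    ((b n)%:E * stream_law P mZ (E n))%E.
  have := independent_coord QP (mray (b n)) (mE n) (EM n) => ->.
  by rewrite muM// uniform_prob_ray.
rewrite -Qn.
have muF : mu iF [set n%:R] = P (found @^-1` [set n]).
  transitivity (stream_law P mZ ([set z | [set n%:R] (z iF)] `&` setT)).
    have := independent_coord QP (i := iF) mset1
      (measurableT : measurable (setT : set (@streams R I))) => -> //.
    by rewrite probability_setT mule1.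
  rewrite setIT stream_lawE; congr (P _); apply/seteqP; split => w /=.
    by rewrite /stream ZF => /eqP; rewrite eqr_nat => /eqP.
  by rewrite /stream ZF => ->.
rewrite -muF; apply: independent_coord => //; first exact: measurableI.
move=> z x; split => -[/= zM zE]; split.
- by move: zM; rewrite upd_neq// eq_sym.
- exact: (EF n z x).1 zE.
- by rewrite /= upd_neq// eq_sym.
- exact: (EF n z x).2 zE.
Qed.

End found.

Section weighted_found.
Context {R : realType} d (T : measurableType d) (P : probability T R) (I : eqType).
Notation L := (measurableTypeR R).
Variables (found : T -> nat) (mfound : measurable_fun setT found).
Variables (Z : I -> T -> R) (mZ : forall i, measurable_fun setT (Z i : T -> L)).
Variables (mu : I -> probability L R) (iF iM : I).
Hypothesis ZF : forall w, Z iF w = (found w)%:R.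
Hypothesis iFM : iF != iM.
Hypothesis QP : product_law (stream_law P mZ) mu.
Hypothesis muM : forall B : set L, measurable B -> mu iM B = uniform_prob (@ltr01 R) B.
Variables (p b : nat -> R) (c : R).
Hypothesis p_ge0 : forall n, 0 <= p n.
Hypothesis p0 : p 0%N = 1.
Hypothesis found_law : forall n, P (found @^-1` [set n]) = (c * p n)%:E.
Hypothesis b01 : forall n, 0 <= b n <= 1.

(** The normalising constant c is nonnegative because c = P(found = 0), and it
    does not vanish because the probabilities of all values sum to 1. *)
Lemma found_norm_gt0 : 0 < c.
Proof.
rewrite lt_neqAle; apply/andP; split; last first.
  by rewrite -(mulr1 c) -p0 -lee_fin -found_law.
apply/eqP => c0.
have mfn n : measurable (found @^-1` [set n]).
  by rewrite -[X in measurable X]setTI; exact: mfound.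
have : P setT = 0%E.
  rewrite (_ : setT = \bigcup_n (found @^-1` [set n])); last first.
    by apply/seteqP; split => w // _; exists (found w).
  rewrite measure_semi_bigcup//; last 2 first.
  - apply/trivIsetP => i j _ _ ij; apply/seteqP; split => w // [/= wi wj].
    by rewrite -wi -wj eqxx in ij.
  - exact: bigcupT_measurable.
  by apply: eseries0 => n _ _; apply: etrans (found_law n) _; rewrite -c0 mul0r.
by rewrite probability_setT => /eqP; rewrite onee_eq0.
Qed.

(** The normalising constant c cancels in the quotient, and the mark contributes
    the factor b n by independence. *)
Lemma cond_prob_over_found (E : nat -> set (@streams R I)) :
  (forall n, measurable (E n)) ->
  (forall n z x, E n (upd z iF x) <-> E n z) ->
  (forall n z x, E n (upd z iM x) <-> E n z) ->
  cond_prob P [set w | E (found w) (stream Z w)] [set w | Z iM w < b (found w)] =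
  fine (\sum_(0 <= n <oo) ((p n * b n)%:E * stream_law P mZ (E n))) /
  fine (\sum_(0 <= n <oo) (p n * b n)%:E).
Proof.
move=> mE EF EM.
have fineZ x : fine (c%:E * x) = c * fine x.
  have c0 := found_norm_gt0.
  by case: x => [r| |] //=; rewrite mulr0 ?gt0_muley ?gt0_muleNy// lte_fin.
have sumE (E' : nat -> set (@streams R I)) :
  (forall n, measurable (E' n)) ->
  (forall n z x, E' n (upd z iF x) <-> E' n z) ->
  (forall n z x, E' n (upd z iM x) <-> E' n z) ->
  fine (P ([set w | E' (found w) (stream Z w)] `&` [set w | Z iM w < b (found w)])) =
  c * fine (\sum_(0 <= n <oo) ((p n * b n)%:E * stream_law P mZ (E' n))).
  move=> mE' E'F E'M; have /= := sum_over_found mfound ZF iFM QP muM b01 mE' E'F E'M.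
  rewrite -fineZ => sE; congr fine; apply: (etrans sE).
  rewrite -nneseriesZl//; last first.
    move=> n _; apply: mule_ge0; last exact: measure_ge0.
    by have /andP[b0 _] := b01 n; rewrite lee_fin mulr_ge0.
  apply: eq_eseriesr => n _.
  have := found_law n => ->; rewrite !EFinM.
  by rewrite !muleA.
have sumT : fine (P [set w | Z iM w < b (found w)]) =
    c * fine (\sum_(0 <= n <oo) (p n * b n)%:E).
  have := sumE (fun=> setT) (fun=> measurableT).
  rewrite (_ : _ `&` _ = [set w | Z iM w < b (found w)]); last first.
    by apply/seteqP; split => w // -[].
  move=> -> //; congr (_ * fine _); apply: eq_eseriesr => n _.
  by rewrite probability_setT mule1.
rewrite /cond_prob sumE// sumT invfM mulrACA divff ?mul1r// gt_eqF//.
exact: found_norm_gt0.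
Qed.

End weighted_found.

(** * The two queues *)

Section systems.
Context {R : realType}.
Notation L := (measurableTypeR R).
Variables (rho : R) (rho_gt0 : 0 < rho).

Lemma measurable_RV d (T : measurableType d) (P : probability T R)
  (f : {RV P >-> R}) : measurable_fun setT (f : T -> L).
Proof. exact: (@measurable_funP _ _ _ _ setT f). Qed.

Section sources.
Context d (T : measurableType d) (P : probability T R) (X : queue_data P).

Lemma measurable_source_rv s : measurable_fun setT (source_rv X s : T -> L).
Proof.
case: s => [|i|j|j|j] /=; try exact: measurable_RV.
by apply: (@measurable_natfun _ _ _ L (found X) (fun n => n%:R)); exact: (@measurable_funP _ _ _ _ setT (found X)).
Qed.

Definition found_law := image_probability P (measurable_source_rv Defs.Found).

Lemma source_rv_law b s : balking_laws rho b X ->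
  has_law P (source_rv X s) (queue_law rho_gt0 found_law s).
Proof.
move=> [_ lres lgap lwork lmark] B mB; case: s => [|i|j|j|j] /=.
- by rewrite image_probabilityE.
- by rewrite exp_lawE; exact: lres.
- by rewrite exp_lawE; exact: lgap.
- by rewrite exp_lawE; exact: lwork.
- exact: lmark.
Qed.

Lemma ps_product_law b : ps_queue rho b X ->
  product_law (stream_law P measurable_source_rv) (queue_law rho_gt0 found_law).
Proof.
move=> [lX indX]; apply: product_law_stream => // s; exact: source_rv_law lX.
Qed.

End sources.

Section ros_sources.
Context d (T : measurableType d) (P : probability T R) (Y : queue_data P).
Variable pick : nat -> {RV P >-> R}.

Definition ros_source (s : source + nat) : T -> R :=
  match s with inl s => source_rv Y s | inr c => pick c end.

Lemma measurable_ros_source s : measurable_fun setT (ros_source s : T -> L).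
Proof.
case: s => [s|c]; first exact: measurable_source_rv.
exact: measurable_RV.
Qed.

Lemma ros_product_law br : ros_queue rho br Y pick ->
  product_law (stream_law P measurable_ros_source) (ros_law rho_gt0 (found_law Y)).
Proof.
move=> [lY lpick indY]; apply: product_law_stream => // -[s|c].
  exact: source_rv_law lY.
exact: lpick.
Qed.

End ros_sources.

End systems.

Section tails.
Context {R : realType}.
Notation L := (measurableTypeR R).
Variables (rho : R) (rho_gt0 : 0 < rho) (b br : nat -> R).
Hypothesis b01 : forall n, 0 <= b n <= 1.
Hypothesis br01 : forall n, 0 <= br n <= 1.
Hypothesis br0 : br 0%N = 1.
Hypothesis brS : forall n, br n.+1 = b n.

(** The common value of the probabilities that V_n and W_n exceed t. *)
Definition late (t : R) n : \bar R :=
  (1 - limn (fun m => served_within rho_gt0 b t m n 0))%E.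

Lemma setC_le T (X : T -> \bar R) (t : R) :
  [set z | (t%:E < X z)%E] = ~` [set z | (X z <= t%:E)%E].
Proof. by apply/seteqP; split => z /=; rewrite ltNge => /negP. Qed.

Lemma weight_ge0 n k : 0 <= rho ^+ n * \prod_(i < k) b i.
Proof.
apply: mulr_ge0; first by apply: exprn_ge0; exact: ltW.
by apply: prodr_ge0 => i _; have /andP[] := b01 i.
Qed.

Lemma prod_shift n : \prod_(i < n.+1) br i = \prod_(i < n) b i.
Proof.
rewrite big_ord_recl br0 mul1r; apply: eq_bigr => i _.
by rewrite -brS.
Qed.

Section ps.
Context d (T : measurableType d) (P : probability T R) (X : queue_data P).
Hypothesis PS : ps_queue rho b X.

Lemma ps_tailE (t : R) : ps_tail b X t =
  fine (\sum_(0 <= n <oo) ((rho ^+ n * \prod_(i < n.+1) b i)%:E * late t n)) /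
  fine (\sum_(0 <= n <oo) (rho ^+ n * \prod_(i < n.+1) b i)%:E).
Proof.
have QP := ps_product_law rho_gt0 PS.
have [[[c foundc] _ _ _ _] _] := PS.
have mfound : measurable_fun setT (found X) := @measurable_funP _ _ _ _ setT (found X).
have mE n : measurable [set z : @streams R source | (t%:E < ps_sojourn_of b n z)%E].
  by rewrite setC_le; apply: measurableC; exact: measurable_ps_sojourn_le.
pose p n := rho ^+ n * \prod_(i < n) b i.
have p0 : p 0%N = 1 by rewrite /p big_ord0 mulr1.
have pb n : p n * b n = rho ^+ n * \prod_(i < n.+1) b i.
  by rewrite /p -mulrA big_ord_recr.
have EU i : i = Defs.Found \/ i = Mark 0 -> forall n (z : @streams R source) x,
    (t%:E < ps_sojourn_of b n (upd z i x))%E <-> (t%:E < ps_sojourn_of b n z)%E.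
  move=> iE n z x; rewrite !ltNge; split => /negP h; apply/negP;
    by move=> /(ps_sojourn_le_upd b n z x t iE).
have tailE n : stream_law P (measurable_source_rv X)
    [set z : @streams R source | (t%:E < ps_sojourn_of b n z)%E] = late t n.
  rewrite setC_le probability_setC; last exact: measurable_ps_sojourn_le.
  by rewrite (ps_sojourn_cdf b01 n t QP).
have := @cond_prob_over_found _ _ _ P _ _ mfound _ _ _ Defs.Found (Mark 0)
  (fun=> erefl) isT QP (fun _ _ => erefl) _ _ _ (fun n => weight_ge0 n n) p0
  foundc b01 _ mE (EU _ (or_introl erefl)) (EU _ (or_intror erefl)).
move=> tE; apply: (etrans tE).
by congr (fine _ / fine _); apply: eq_eseriesr => n _; rewrite -pb// tailE.
Qed.

End ps.

Section ros.
Context d (T : measurableType d) (P : probability T R) (Y : queue_data P).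
Variable pick : nat -> {RV P >-> R}.
Hypothesis ROS : ros_queue rho br Y pick.

(** A customer finding n + 1 others starts with n waiting competitors, and one
    finding the system empty does not wait: the first term vanishes and the
    shift of the index produces the factor rho, because
    br 0 ... br n.+1 = b 0 ... b n. *)
Lemma ros_tailE (t : R) : 0 <= t -> ros_tail br Y pick t =
  fine (rho%:E * \sum_(0 <= n <oo) ((rho ^+ n * \prod_(i < n.+1) b i)%:E * late t n)) /
  fine (\sum_(0 <= n <oo) (rho ^+ n * \prod_(i < n) b i)%:E).
Proof.
move=> t0; have QP := ros_product_law rho_gt0 ROS.
have [[[c foundc] _ _ _ _] _ _] := ROS.
have mfound : measurable_fun setT (found Y) := @measurable_funP _ _ _ _ setT (found Y).
pose Z := (source + nat)%type.
pose E n : set (@streams R Z) :=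
  if n is n'.+1 then [set z | (t%:E < ros_wait_of br n' z)%E] else set0.
have mE n : measurable (E n).
  case: n => [|n] //=; rewrite setC_le; apply: measurableC.
  exact: measurable_ros_wait_le.
pose p n := rho ^+ n * \prod_(i < n) br i.
have p_ge0 n : 0 <= p n.
  apply: mulr_ge0; first by apply: exprn_ge0; exact: ltW.
  by apply: prodr_ge0 => i _; have /andP[] := br01 i.
have p0 : p 0%N = 1 by rewrite /p big_ord0 mulr1.
have pbr n : p n * br n = rho ^+ n * \prod_(i < n) b i.
  by rewrite /p -prod_shift big_ord_recr mulrA.
have EU i : i = inl Defs.Found \/ i = inl (Mark 0) ->
    forall n (z : @streams R Z) x, E n (upd z i x) <-> E n z.
  move=> iE [|n] z x //=; rewrite !ltNge; split => /negP h; apply/negP;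
    by move=> /(ros_wait_le_upd br n z x t iE).
have late_ge0 n : (0 <= late t n)%E /\
    stream_law P (measurable_ros_source Y pick) (E n.+1) = late t n.
  have QE : stream_law P (measurable_ros_source Y pick) (E n.+1) = late t n.
    rewrite /= setC_le probability_setC; last exact: measurable_ros_wait_le.
    by rewrite (ros_wait_cdf b01 brS n t QP).
  by split => //; rewrite -QE; exact: measure_ge0.
have := @cond_prob_over_found _ _ _ P _ _ mfound _ _ _ (inl Defs.Found) (inl (Mark 0))
  (fun=> erefl) isT QP (fun _ _ => erefl) _ _ _ p_ge0 p0
  foundc br01 _ mE (EU _ (or_introl erefl)) (EU _ (or_intror erefl)).
rewrite (_ : mkset _ = [set w | (t%:E < ros_wait_steady br Y pick w)%E]); last first.
  apply/seteqP; split => w /=; rewrite /E /ros_wait_steady; case: (found Y w) => //=.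
  by rewrite lte_fin ltNge t0.
move=> tE; apply: (etrans tE).
have weight1 n : (0 <= (p n * br n)%:E)%E by rewrite lee_fin pbr weight_ge0.
congr (fine _ / fine _); last by apply: eq_eseriesr => n _; rewrite pbr.
rewrite (@nneseries_recl _ xpredT)//; last by move=> n _; exact: mule_ge0.
rewrite measure0 mule0 add0e -(nneseries_addn 1); last by move=> n; exact: mule_ge0.
rewrite -nneseriesZl//; last first.
  move=> n _; apply: mule_ge0; last by case: (late_ge0 n).
  by rewrite lee_fin weight_ge0.
apply: eq_eseriesr => n _; rewrite addn1; case: (late_ge0 n) => _ ->.
by rewrite muleA -EFinM pbr exprS mulrA.
Qed.

End ros.

End tails.

Theorem proposition1 (R : realType) (rho : R) (b br : nat -> R)
    (d : measure_display) (T : measurableType d) (P : probability T R)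
    (X : queue_data P)
    (d' : measure_display) (T' : measurableType d') (P' : probability T' R)
    (Y : queue_data P') (pick : nat -> {RV P' >-> R})
    (rho_gt0 : 0 < rho)
    (b_prob : forall n, 0 <= b n <= 1) (br_prob : forall n, 0 <= br n <= 1)
    (b0 : b 0%N = 1)
    (b_sum : cvgn (fun N => \sum_(1 <= n < N) rho ^+ n * \prod_(i < n) b i))
    (PS : ps_queue rho b X) (ROS : ros_queue rho br Y pick)
    (br0 : br 0%N = 1) (brS : forall n, br n.+1 = b n) :
  (forall n, eq_in_law P P' (ps_sojourn b X n) (ros_wait br Y pick n)) /\
  (forall t : R, 0 <= t ->
    ps_tail b X t =
    rho^-1 *
    ((1 + limn (fun N => \sum_(1 <= n < N) rho ^+ n * \prod_(i < n) b i)) /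
     (1 + limn (fun N => \sum_(1 <= n < N) rho ^+ n * \prod_(i < n.+1) b i))) *
    ros_tail br Y pick t).
Proof.
split=> [n|t t0].
  have QX := ps_product_law rho_gt0 PS; have QY := ros_product_law rho_gt0 ROS.
  have mX := measurable_stream (measurable_source_rv X).
  have mY := measurable_stream (measurable_ros_source Y pick).
  apply: eq_in_law_le => t.
  - have /= := mX measurableT _ (measurable_ps_sojourn_le b n t).
    by rewrite setTI.
  - have /= := mY measurableT _ (measurable_ros_wait_le br n t).
    by rewrite setTI.
  - have lX := ps_sojourn_cdf b_prob n t QX.
    have lY := ros_wait_cdf b_prob brS n t QY.
    by rewrite stream_lawE in lX; rewrite stream_lawE in lY; apply: etrans lX (esym lY).
pose s n := rho ^+ n * \prod_(i < n) b i.
pose a n := rho ^+ n * \prod_(i < n.+1) b i.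
have s_ge0 n : 0 <= s n := weight_ge0 rho_gt0 b_prob n n.
have a_ge0 n : 0 <= a n := weight_ge0 rho_gt0 b_prob n n.+1.
have as_ n : a n <= s n.
  rewrite /a big_ord_recr /= mulrA ler_piMr//; first exact: s_ge0.
  by have /andP[] := b_prob n.
have psum_nd (u : nat -> R) : (forall n, 0 <= u n) ->
    nondecreasing_seq (fun N => \sum_(1 <= n < N) u n).
  move=> u0; apply/nondecreasing_seqP => -[|N]; first by rewrite !big_geq.
  by rewrite [leRHS]big_nat_recr//= lerDl.
(* as b <= 1, this series is dominated by the one of [b_sum] *)
have cva : cvgn (fun N => \sum_(1 <= n < N) a n).
  apply: nondecreasing_is_cvgn; first exact: psum_nd.
  exists (limn (fun N => \sum_(1 <= n < N) s n)) => _ [N _ <-].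
  apply: (@le_trans _ _ (\sum_(1 <= n < N) s n)); first exact: ler_sum.
  exact: nondecreasing_cvgn_le (psum_nd _ s_ge0) b_sum N.
have lims_gt0 : 0 < 1 + limn (fun N => \sum_(1 <= n < N) s n).
  apply: ltr_pwDl => //; apply: limr_ge => //.
  by apply: nearW => N; exact: sumr_ge0.
rewrite (ps_tailE rho_gt0 b_prob PS) (ros_tailE rho_gt0 b_prob br_prob br0 brS ROS t0).
rewrite (@nneseries_limn _ a)//; last by rewrite /a big_ord_recl b0 big_ord0 !mulr1.
rewrite (@nneseries_limn _ s)//; last by rewrite /s big_ord0 mulr1.
rewrite /=.
have -> x : fine (rho%:E * x) = rho * fine x.
  by case: x => [r| |] //=; rewrite mulr0 ?gt0_muley ?gt0_muleNy// lte_fin.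
have cancel (N S D : R) : S != 0 -> N / D = rho^-1 * (S / D) * (rho * N / S).
  move=> S0; rewrite [RHS](_ : _ = N * (rho^-1 * rho) * (S / S) / D); last by ring.
  by rewrite mulVf ?gt_eqF// divff// !mulr1.
by apply: cancel; rewrite gt_eqF.
Qed.
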